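(* Let $d\ge 1$, let $H\in(\tfrac12,1)$ and let $\boldsymbol{B}_t=(B^1_t,\dots,B^d_t)$ be a $d$-dimensional fractional Brownian motion with Hurst parameter $H$. Let $I_p=(i_1,\dots,i_p)$ and $J_q=(j_1,\dots,j_q)$ be tuples of elements of $\{1,\dots,d\}$ with $p+q=2k=n$ for an integer $k\ge 1$, and let $S_{I_p}(\boldsymbol{B}_t)_{st}$ and $S_{J_q}(\boldsymbol{B}_t)_{st}$ be the corresponding $p$-th and $q$-th order iterated integrals over $[s,t]$. Then for $0\le s<t\le T$, $$\mathbb{E}\big[S_{I_p}(\boldsymbol{B}_t)_{st}\,S_{J_q}(\boldsymbol{B}_t)_{st}\big]\le \frac{2^{2k}}{k!}\,(t-s)^{2kH}.$$
   Context: A $d$-dimensional fractional Brownian motion with Hurst parameter $H\in(0,1)$ is a zero-mean Gaussian process $\boldsymbol{B}_t=(B^1_t,\dots,B^d_t)$, $t\ge0$, with independent components, each having covariance $\mathbb{E}[B^i_tB^i_s]=\frac12\left(t^{2H}+s^{2H}-|t-s|^{2H}\right)$. For a tuple $I=(i_1,\dots,i_m)$ of elements of $\{1,\dots,d\}$, the signature component of order $m$ over $[s,t]$ is the iterated integral $$S_I(\boldsymbol{B}_t)_{st}=\int_{s<t_1<\dots<t_m<t} dB^{i_1}_{t_1}\cdots dB^{i_m}_{t_m},$$ defined recursively (integrating successively against $dB^{i_1},\dots,dB^{i_m}$) with each integral taken pathwise in the Young sense, which is possible for $H>\frac12$ since the paths are almost surely $\gamma$-Hölder for every $\gamma<H$.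 The order-$0$ component is $1$. $T>0$ is a fixed time horizon. *)

(* Defs.v *)
From HB Require Import structures.
From mathcomp Require Import all_boot all_order all_algebra.
From mathcomp Require Import all_classical all_reals all_analysis.

Set Implicit Arguments.
Unset Strict Implicit.
Unset Printing Implicit Defensive.

Import Order.TTheory GRing.Theory Num.Theory.
Import numFieldNormedType.Exports.

Local Open Scope classical_set_scope.
Local Open Scope ring_scope.

Section young_integral.
Context {R : realType}.
Implicit Types (f g : R -> R) (a b : R) (s : seq R).

(* As in [variation], a partition a = t_0 < ... < t_n = b of [a, b] is encoded
   by s = [:: t_1; ...; t_n]. *)
Definition partition_node a b s (i : nat) : R := nth b (a :: s) i.

Definition partition_mesh_lt (delta : R) a b s : Prop :=
  forall i, (i < size s)%N ->
    partition_node a b s i.+1 - partition_node a b s i < delta.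

Definition partition_tags a b s (xi : nat -> R) : Prop :=
  forall i, (i < size s)%N ->
    partition_node a b s i <= xi i <= partition_node a b s i.+1.

Definition stieltjes_sum f g a b s (xi : nat -> R) : R :=
  \sum_(0 <= i < size s)
    f (xi i) * (g (partition_node a b s i.+1) - g (partition_node a b s i)).

(* Young's integral of f against g over [a, b]: the limit of the tagged
   Riemann-Stieltjes sums as the mesh tends to 0. By Young's theorem it exists
   if f and g are Hoelder continuous with exponents of sum > 1. *)
Definition is_young_integral f g a b (l : R) : Prop :=
  forall eps : R, 0 < eps -> exists2 delta : R, 0 < delta &
    forall s xi, itv_partition a b s -> partition_mesh_lt delta a b s ->
      partition_tags a b s xi -> `|stieltjes_sum f g a b s xi - l| < eps.

(* For a <= b the limit is unique when it exists; the value is unspecified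
   when it does not. *)
Definition young_integral f g a b : R := get (is_young_integral f g a b).

(* S_[::] = 1 and S_(rcons I i) over [s, t] is the integral over u in [s, t]
   of S_I over [s, u] against d(X i)_u. *)
Definition signature d (X : 'I_d -> R -> R) (I : seq 'I_d) (s t : R) : R :=
  foldl (fun (F : R -> R) i u => young_integral F (X i) s u) (fun=> 1) I t.

(* Hoelder continuity on every compact subinterval of [0, +oo[. *)
Definition locally_hoelder (gamma : R) f : Prop :=
  forall b, 0 <= b -> exists C : R, forall u v : R,
    0 <= u <= b -> 0 <= v <= b -> `|f u - f v| <= C * `|u - v| `^ gamma.

End young_integral.

Section fractional_brownian_motion.
Context {disp : measure_display} {Omega : measurableType disp} {R : realType}.
Variable P : probability Omega R.

(* Constants are Gaussian; they need a separate clause because the library's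
   [normal_prob m 0] is not the Dirac mass at m. *)
Definition gaussian (X : Omega -> R) : Prop :=
  exists m sigma : R, forall A : set R, measurable A ->
    P (X @^-1` A) = if sigma == 0 then \d_m A else normal_prob m sigma A.

Definition process_sigma_algebra (X : R -> {RV P >-> R}) : set (set Omega) :=
  <<s \bigcup_(t in [set t | 0 <= t])
        preimage_set_system [set: Omega] (X t) measurable >>.

(* Each generated sigma-algebra contains the whole space, so the product rule
   over the full family includes the one over subfamilies. *)
Definition independent_processes d (X : 'I_d -> R -> {RV P >-> R}) : Prop :=
  forall E : 'I_d -> set Omega,
    (forall i, process_sigma_algebra (X i) (E i)) ->
    P (\bigcap_i E i) = (\prod_(i < d) P (E i))%E.

Definition gaussian_process d (X : 'I_d -> R -> {RV P >-> R}) : Prop :=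
  forall (n : nat) (i : 'I_n -> 'I_d) (t c : 'I_n -> R),
    (forall j, 0 <= t j) ->
    gaussian (fun w => \sum_(j < n) c j * X (i j) (t j) w).

(* Only the times t >= 0 matter. The Gaussian law does not determine the paths;
   [fbm_hoelder] selects the version with regular paths, for which the
   iterated Young integrals exist almost surely when H > 1/2. *)
Record fractional_brownian_motion (H : R) d (B : 'I_d -> R -> {RV P >-> R}) :
    Prop := {
  fbm_gaussian : gaussian_process B ;
  fbm_centered : forall i (t : R), 0 <= t -> ('E_P[B i t] = 0)%E ;
  fbm_independent : independent_processes B ;
  fbm_covariance : forall i (s t : R), 0 <= s -> 0 <= t ->
    ('E_P[fun w => (B i t w * B i s w)%R] =
     (2^-1 * (t `^ (2 * H) + s `^ (2 * H) - `|t - s| `^ (2 * H)))%:E)%E ;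
  fbm_hoelder : forall i (gamma : R), 0 < gamma < H ->
    {ae P, forall w, locally_hoelder gamma (fun t => B i t w)} }.

End fractional_brownian_motion.

(* Main.v *)
Require Import Defs.
From HB Require Import structures.
From mathcomp Require Import all_boot all_order all_algebra.
From mathcomp Require Import all_classical all_reals all_analysis.
From mathcomp Require Import measurable_realfun ring lra zify.

Set Implicit Arguments.
Unset Strict Implicit.
Unset Printing Implicit Defensive.

Import Order.TTheory GRing.Theory Num.Theory.
Import numFieldNormedType.Exports.

Local Open Scope classical_set_scope.
Local Open Scope ring_scope.

(** Write S_I for the signature component of I over [s, t]. For every lam > 0
    the arithmetic-geometric mean inequality gives
      E[S_I S_J] <= (lam E[S_I^2] + lam^-1 E[S_J^2]) / 2,
    so that second moments suffice. With a = 4 (t - s)^(2H) and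
    A_n = a^n / n! one has E[S_I^2] <= A_p for I of length p
    ([integral_signature_sqr_le]); taking lam = A_k / A_p, the right-hand side
    above is at most A_k, because A_p A_q <= A_k^2, that is (k!)^2 <= p! q!
    whenever p + q = 2k ([leq_sqr_fact_sum]). And A_k is the claimed bound.

    The second moment of S_I. Almost surely S_I is the limit of iterated
    left-point Riemann sums along uniform grids ([cvg_grid_signature]), so by
    Fatou's lemma it is enough to bound the second moments of these sums, which
    are polynomials with nonnegative coefficients in the increments of B over
    the grid. Two increments of one component have nonnegative covariance
    since H > 1/2, and increments of different components are uncorrelated. By
    Isserlis' formula ([isserlis]) the mean of a product of centred jointly
    Gaussian variables is a nonnegative combination of products of their
    covariances, hence grows with them ([isserlis_le]): replacing each
    component by a single one, i0, increases the mean of each monomial. With a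
    single component, p! times the iterated sum is dominated coefficientwise by
    the p-th power of the total increment D of B^i0 over [s, t]
    ([dominated_discrete_signature]). Thus
      (p!)^2 E[S_I^2] <= E[D^(2p)] = c_p (t - s)^(2Hp),
    where c_p is the moment of order 2p of the standard normal law, and
    c_p <= 4^p p! ([gauss_ratio_le]).

    The pathwise part. Young's estimate in a discrete form ([discrete_sewing])
    serves to build the integral function ([sewing]), which is then shown to be
    a Young integral with Hoelder continuous paths ([young_integral_exists],
    [signature_holder]), and serves again to control the difference between the
    signature and its grid version. This difference is shown to be Hoelder on
    the grid with a constant tending to 0 ([grid_signature_error]); a bound in
    the supremum norm would not propagate from one iterated integral to the
    next.

    S_I and S_I S_J may fail to be measurable, as the paths are regular only
    outside a null set. The lower limit of the squared grid sums is a
    measurable function almost everywhere equal to S_I^2, and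
    [integral_le_ae_dominated] bounds the integral of an arbitrary function by
    that of a measurable one lying above it almost everywhere. *)

(** * Young's estimate and the sewing lemma *)

Section sewing.
Context {R : realType}.
Implicit Types (x y a b h theta gamma M : R).

Lemma ler_powR_r x y theta : 0 <= theta -> 0 <= x -> x <= y ->
  x `^ theta <= y `^ theta.
Proof.
move=> th0 x0 xy; apply: ge0_ler_powR => //; rewrite nnegrE //.
exact: le_trans xy.
Qed.

Lemma powR_le_mesh x h theta : 1 < theta -> 0 <= x -> x <= h ->
  x `^ theta <= h `^ (theta - 1) * x.
Proof.
move=> th1 x0 xh; rewrite -mulr_powRB1 //; last by lra.
rewrite mulrC ler_wpM2r // ler_powR_r //; lra.
Qed.

(** As theta > 1, the sum of the theta-th powers of the cells is small with the
    mesh h: this is how second-order errors vanish in all limits below. *)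
Lemma sum_powR_mesh (x : nat -> R) n h theta : 1 < theta ->
  (forall i, (i < n)%N -> 0 <= x i.+1 - x i <= h) ->
  \sum_(0 <= i < n) (x i.+1 - x i) `^ theta <= h `^ (theta - 1) * (x n - x 0).
Proof.
move=> th1 xh.
rewrite -(telescope_sumr x (leq0n n)).
rewrite mulr_sumr big_nat [leRHS]big_nat; apply: ler_sum => i /andP[_ ni].
by have /andP[? ?] := xh _ ni; exact: powR_le_mesh.
Qed.

(** The solution K of K = 2 K (1/2)^theta + 2, the recursion that the bisection
    argument of [discrete_sewing] produces. *)
Definition sewing_const theta := 2 / (1 - 2 `^ (1 - theta)).

Lemma powR_2_lt1 theta : 1 < theta -> 2 `^ (1 - theta) < 1 :> R.
Proof.
move=> th; rewrite -[ltRHS](powRr0 2) /powR ifF ?pnatr_eq0 //.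
rewrite ltr_expR mul0r pmulr_llt0 ?ln_gt0 //; lra.
Qed.

Lemma sewing_const_ge0 theta : 1 < theta -> 0 <= sewing_const theta.
Proof.
move=> th; rewrite divr_ge0 // subr_ge0 ltW // powR_2_lt1 //.
Qed.

Lemma sewing_constE theta x : 1 < theta -> 0 <= x ->
  2 * (sewing_const theta * (x / 2) `^ theta) + 2 * x `^ theta =
  sewing_const theta * x `^ theta.
Proof.
move=> th x0; rewrite powRM ?invr_ge0 // -powR_inv1 // -powRrM mulN1r.
have := powR_2_lt1 th.
have E : (2 : R) `^ (1 - theta) = 2 * 2 `^ (- theta).
  by rewrite powRD ?powRr1 // pnatr_eq0 implybT.
rewrite /sewing_const {}E => lt1.
by field; lra.
Qed.

(** Young's estimate. Let j be the last point of the left half of [x i, x k].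
    Removing the cell from j to j+1 leaves two blocks of points whose lengths
    are at most half of the total one, and costs two defects. By induction the
    error is at most 2 K M (L/2)^theta + 2 M L^theta = K M L^theta. *)
Lemma discrete_sewing (Xi : nat -> nat -> R) (x : nat -> R) n M theta :
  1 < theta -> 0 <= M ->
  (forall i, (i < n)%N -> x i <= x i.+1) ->
  (forall i, (i <= n)%N -> Xi i i = 0) ->
  (forall i j k, (i <= j)%N -> (j <= k)%N -> (k <= n)%N ->
    `|Xi i k - Xi i j - Xi j k| <= M * (x k - x i) `^ theta) ->
  forall i k, (i <= k)%N -> (k <= n)%N ->
  `|\sum_(i <= l < k) Xi l l.+1 - Xi i k| <=
    sewing_const theta * M * (x k - x i) `^ theta.
Proof.
move=> th M0 ndx Xi0 defect i k; have [m] := ubnP (k - i).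
have ndx' i' k' : (i' <= k')%N -> (k' <= n)%N -> x i' <= x k'.
  move=> ik; rewrite -(subnKC ik); elim: (k' - i')%N => [|l IH] kn.
    by rewrite addn0.
  apply: (le_trans (IH _)); first by rewrite (leq_trans _ kn)// leq_add2l.
  by rewrite addnS ndx// -addnS.
have K0 := sewing_const_ge0 th.
elim: m i k => // m IH i k kim ik kn.
have KM0 : 0 <= sewing_const theta * M by rewrite mulr_ge0.
have [->|nik] := eqVneq i k.
  by rewrite big_geq // Xi0 // subr0 normr0 mulr_ge0 // powR_ge0.
have {nik}ik' : (i < k)%N by rewrite ltn_neqAle nik.
have L0 : 0 <= x k - x i by rewrite subr_ge0 ndx'.
set L := x k - x i in L0 *.
(* [Q] holds at i, and the last j satisfying it is where the sum is cut. *)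
pose Q j := [&& (i <= j)%N, (j < k)%N & x j - x i <= L / 2].
have exQ : exists j, Q j.
  by exists i; rewrite /Q leqnn ik' subrr divr_ge0.
have ubQ j : Q j -> (j <= k)%N by case/and3P=> _ /ltnW.
have [j /and3P[ij jk xj] maxj] := ex_maxnP exQ ubQ.
have xj1 : x k - x j.+1 <= L / 2.
  have [jk1|jk1] := ltnP j.+1 k; last first.
    have -> : k = j.+1 by apply/eqP; rewrite eqn_leq jk jk1.
    by rewrite subrr divr_ge0.
  have := contraNN (maxj j.+1); rewrite ltnn => /(_ isT).
  by rewrite /Q jk1 leqW //= -ltNge /L; lra.
have xj0 : 0 <= x j - x i by rewrite subr_ge0 ndx' // (leq_trans (ltnW jk)).
have xj10 : 0 <= x k - x j.+1 by rewrite subr_ge0 ndx'.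
have jn : (j.+1 <= n)%N := leq_trans jk kn.
have D1 := defect i j k ij (ltnW jk) kn.
have D2 := defect j j.+1 k (leqnSn _) jk kn.
have {}H1 : `|\sum_(i <= l < j) Xi l l.+1 - Xi i j| <=
    sewing_const theta * M * (L / 2) `^ theta.
  apply: (le_trans (IH i j _ ij (ltnW jn))).
    by rewrite -ltnS; apply: leq_trans kim; rewrite !ltnS ltn_sub2r.
  by rewrite ler_wpM2l // ler_powR_r //; lra.
have {}H2 : `|\sum_(j.+1 <= l < k) Xi l l.+1 - Xi j.+1 k| <=
    sewing_const theta * M * (L / 2) `^ theta.
  apply: (le_trans (IH j.+1 k _ jk kn)).
    rewrite -ltnS; apply: leq_trans kim; rewrite !ltnS ltn_sub2l //.
  by rewrite ler_wpM2l // ler_powR_r //; lra.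
have {}D2 : `|Xi j k - Xi j j.+1 - Xi j.+1 k| <= M * L `^ theta.
  apply: (le_trans D2); rewrite ler_wpM2l // ler_powR_r //; try lra.
    by rewrite subr_ge0 ndx' // ltnW.
  by rewrite /L; lra.
rewrite (big_cat_nat (n := j)) //=; last exact: ltnW.
rewrite (big_ltn jk).
have := sewing_constE th L0 => E.
have -> : sewing_const theta * M * L `^ theta =
  sewing_const theta * M * (L / 2) `^ theta +
  sewing_const theta * M * (L / 2) `^ theta + M * L `^ theta + M * L `^ theta.
  by rewrite mulrAC -E; ring.
set S1 := \sum_(i <= _ < _) _ in H1 *; set S2 := \sum_(j.+1 <= _ < _) _ in H2 *.
have -> : S1 + (Xi j j.+1 + S2) - Xi i k = (S1 - Xi i j) + (S2 - Xi j.+1 k)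
   - (Xi j k - Xi j j.+1 - Xi j.+1 k) - (Xi i k - Xi i j - Xi j k) by ring.
apply: (le_trans (ler_normB _ _)); apply: lerD => //.
apply: (le_trans (ler_normB _ _)); apply: lerD => //.
by apply: (le_trans (ler_normD _ _)); apply: lerD.
Qed.

End sewing.

Section sewing_map.
Context {R : realType}.
Variables (Xi : R -> R -> R) (a b M theta : R).
Hypotheses (ab : a <= b) (M0 : 0 <= M) (th1 : 1 < theta).
Hypothesis defect : forall u v w, a <= u -> u <= v -> v <= w -> w <= b ->
  `|Xi u w - Xi u v - Xi v w| <= M * (w - u) `^ theta.

Let th0 : 0 <= theta.
Proof. exact: ltW (lt_trans ltr01 th1). Qed.

(* The dyadic points of [a, b] clamped to [u, v] form a partition of [u, v] with
   repeated points, so that the sums over all subintervals share their cells. *)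
Let clamp (u v z : R) := Num.max u (Num.min v z).

Let Xi_diag u : a <= u -> u <= b -> Xi u u = 0.
Proof.
move=> au ub; have := defect au (lexx u) (lexx u) ub.
rewrite !subrr powR0 ?mulr0; last by rewrite gt_eqF // (lt_trans ltr01).
by rewrite sub0r normrN normr_le0 => /eqP.
Qed.

Let dnode n (j : nat) : R := a + (b - a) * (j%:R / 2 ^+ n).
Let dmesh n : R := (b - a) / 2 ^+ n.

Let dmesh_ge0 n : 0 <= dmesh n.
Proof. by rewrite divr_ge0 ?subr_ge0 // exprn_ge0. Qed.

Let dnodeS n j : dnode n j.+1 - dnode n j = dmesh n.
Proof. by rewrite /dnode /dmesh -natr1; field; rewrite expf_neq0. Qed.

Let dnode_le n j : dnode n j <= dnode n j.+1.
Proof. by rewrite -subr_ge0 dnodeS. Qed.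

Let dnode0 n : dnode n 0 = a.
Proof. by rewrite /dnode mul0r mulr0 addr0. Qed.

Let dnode_last n : dnode n (2 ^ n) = b.
Proof. by rewrite /dnode natrX divff ?expf_neq0 //; ring. Qed.

Let dnode_ge n j : a <= dnode n j.
Proof.
by elim: j => [|j IH]; [rewrite dnode0|exact: le_trans (dnode_le _ _)].
Qed.

Let dnode_even n j : dnode n.+1 (j.*2) = dnode n j.
Proof.
by rewrite /dnode -muln2 natrM exprS; field; rewrite expf_neq0.
Qed.

Let riemann n u v := \sum_(0 <= j < 2 ^ n)
  Xi (clamp u v (dnode n j)) (clamp u v (dnode n j.+1)).

Let clamp_homo u v z z' : z <= z' -> clamp u v z <= clamp u v z'.
Proof.
move=> zz'; rewrite /clamp ge_max le_max lexx /= le_max; apply/orP; right.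
by rewrite le_min !ge_min lexx zz' orbT.
Qed.

Let clamp_ge u v z : u <= clamp u v z.
Proof. by rewrite /clamp le_max lexx. Qed.

Let clamp_le u v z : u <= v -> clamp u v z <= v.
Proof. by move=> uv; rewrite /clamp ge_max uv ge_min lexx. Qed.

Let clamp_lip u v z z' : z <= z' -> clamp u v z' - clamp u v z <= z' - z.
Proof.
move=> zz'; rewrite /clamp /Num.max /Num.min.
by case: (ltP v z) => ?; case: (ltP v z') => ?; case: ltP => ?;
  case: ltP => ?; lra.
Qed.

Let riemann_local n u v : a <= u -> u <= v -> v <= b ->
  `|riemann n u v - Xi u v| <= sewing_const theta * M * (v - u) `^ theta.
Proof.
move=> au uv vb; pose y j := clamp u v (dnode n j).
have y0 : y 0%N = u.
  rewrite /y dnode0 /clamp min_r ?max_l //; exact: le_trans au uv.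
have yl : y (2 ^ n)%N = v.
  rewrite /y dnode_last /clamp min_l ?max_r //.
rewrite -[in Xi u v]y0 -[in Xi _ v]yl -{2}y0 -{2}yl.
apply: (@discrete_sewing _ (fun i k => Xi (y i) (y k)) y (2 ^ n)) => //.
- by move=> i _; apply: clamp_homo.
- move=> i _; apply: Xi_diag; first exact: le_trans au (clamp_ge _ _ _).
  by apply: le_trans vb; apply: clamp_le.
- have hom : {homo y : i j / (i <= j)%N >-> i <= j}.
    by apply: homo_leq => // [? ? ?|i]; [exact: le_trans|exact: clamp_homo].
  move=> i j k ij jk _; apply: defect; rewrite ?hom//.
    exact: le_trans au (clamp_ge _ _ _).
  by apply: le_trans vb; apply: clamp_le.
Qed.

(* The common bound: 2^n cells, each contributing an error of order
   M (2^-n (b - a))^theta, amount to a geometric sequence. *)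
Let cells_le n (F : nat -> R) :
  (forall j, `|F j| <= M * dmesh n `^ theta) ->
  `|\sum_(0 <= j < 2 ^ n) F j| <=
    M * (b - a) `^ theta * (2 `^ (1 - theta)) ^+ n.
Proof.
move=> HF; apply: (le_trans (ler_norm_sum _ _ _)).
apply: (@le_trans _ _ (\sum_(0 <= j < 2 ^ n) M * dmesh n `^ theta)).
  by apply: ler_sum => j _.
rewrite sumr_const_nat subn0 -[leLHS]mulr_natl natrX /dmesh powRM ?subr_ge0
  ?invr_ge0 ?exprn_ge0 //.
rewrite -powR_invn // -!powR_mulrn ?powR_ge0 // -!powRrM.
rewrite mulrCA -!mulrA ler_wpM2l // mulrCA ler_wpM2l ?powR_ge0 //.
rewrite -powRD ?pnatr_eq0 ?implybT //.
suff -> : n%:R + - n%:R * theta = (1 - theta) * n%:R by [].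
by ring.
Qed.

Let riemann_refine n u v : a <= u -> u <= v -> v <= b ->
  `|riemann n.+1 u v - riemann n u v| <=
    M * (b - a) `^ theta * (2 `^ (1 - theta)) ^+ n.
Proof.
move=> au uv vb.
have split2 (F : nat -> R) m : \sum_(0 <= j < m.*2) F j =
    \sum_(0 <= j < m) (F j.*2 + F j.*2.+1).
  elim: m => [|m IH]; first by rewrite !big_geq.
  by rewrite doubleS !big_nat_recr //= IH addrA.
rewrite /riemann expnS mul2n split2 -sumrB; apply: cells_le => j.
rewrite -doubleS !dnode_even.
set p := clamp u v (dnode n j); set q := clamp u v (dnode n j.+1).
set m := clamp u v (dnode n.+1 _).
have e1 : dnode n j <= dnode n.+1 j.*2.+1 by rewrite -dnode_even dnode_le.
have e2 : dnode n.+1 j.*2.+1 <= dnode n j.+1.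
  by rewrite -(dnode_even n j.+1) doubleS dnode_le.
rewrite distrC opprD addrA; apply: (le_trans (defect _ _ _ _)).
- exact: le_trans au (clamp_ge _ _ _).
- exact: clamp_homo.
- exact: clamp_homo.
- by apply: le_trans vb; apply: clamp_le.
rewrite ler_wpM2l // -(dnodeS n j) ler_powR_r ?th0 //.
  by rewrite subr_ge0 clamp_homo // (le_trans e1).
by rewrite clamp_lip // (le_trans e1).
Qed.

(* Additivity fails only in the one cell that contains u, by a defect. *)
Let riemann_additive n u v : a <= u -> u <= v -> v <= b ->
  `|riemann n a v - riemann n a u - riemann n u v| <=
    M * (b - a) `^ theta * (2 `^ (1 - theta)) ^+ n.
Proof.
move=> au uv vb; rewrite /riemann -!sumrB; apply: cells_le => j.
have := dnodeS n j; have := dnode_ge n j; have := dnode_le n j.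
move: (dnode n j) (dnode n j.+1) => p q pq ap pqE.
have bound0 : 0 <= M * dmesh n `^ theta by rewrite mulr_ge0 ?powR_ge0.
have clampa w z : a <= w -> a <= z -> clamp a w z = Num.min w z.
  by move=> aw az; rewrite /clamp max_r // le_min aw.
rewrite !clampa //; try lra.
have [up|/negP/negP] := boolP (u <= p); last rewrite -ltNge => pu.
  rewrite (min_l up) (min_l (le_trans up pq)) /clamp !max_r; last 2 first.
  - by rewrite le_min uv (le_trans up).
  - by rewrite le_min uv.
  by rewrite Xi_diag ?subr0 ?subrr ?normr0 //; exact: le_trans vb.
have pv : p <= v := le_trans (ltW pu) uv.
rewrite (min_r (ltW pu)) (min_r pv).
have -> : clamp u v p = u by rewrite /clamp (min_r pv) max_l // ltW.
have [qu|/negP/negP] := boolP (q <= u); last rewrite -ltNge => uq.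
  rewrite (min_r qu) (min_r (le_trans qu uv)).
  have -> : clamp u v q = u.
    by rewrite /clamp (min_r (le_trans qu uv)) max_l.
  by rewrite Xi_diag ?subr0 ?subrr ?normr0 //; exact: le_trans vb.
rewrite (min_l (ltW uq)).
have um : u <= Num.min v q by rewrite le_min uv ltW.
have -> : clamp u v q = Num.min v q by rewrite /clamp max_r.
have mq : Num.min v q <= q by rewrite ge_min lexx orbT.
apply: (le_trans (defect ap (ltW pu) um _)).
  by rewrite ge_min vb.
by rewrite ler_wpM2l // -pqE ler_powR_r ?th0 //; lra.
Qed.

(** The dyadic sums over [a, u] converge since their successive differences are
    geometric; the local estimate, uniform in n, and additivity up to a
    vanishing error pass to the limit. Taking a function of one variable as the
    limit makes its increments additive at all points, not only dyadic ones. *)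
Lemma sewing : exists Phi : R -> R, forall u v, a <= u -> u <= v -> v <= b ->
  `|Phi v - Phi u - Xi u v| <= sewing_const theta * M * (v - u) `^ theta.
Proof.
pose r : R := 2 `^ (1 - theta).
have r1 : `|r| < 1 by rewrite ger0_norm ?powR_ge0 // powR_2_lt1.
have cvgL u : a <= u -> u <= b -> cvgn (fun n => riemann n a u).
  move=> au ub.
  have cS : cvgn (series (fun n => riemann n.+1 a u - riemann n a u)).
    apply: normed_cvg.
    apply: (series_le_cvg (v_ := geometric (M * (b - a) `^ theta) r)) => //.
    - by move=> n; exact: normr_ge0.
    - by move=> n; rewrite /geometric /= !mulr_ge0 ?exprn_ge0 ?powR_ge0.
    - by move=> n; exact: riemann_refine.
    - exact: is_cvg_geometric_series.
  have -> : (fun n => riemann n a u) = (fun n =>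
      series (fun n => riemann n.+1 a u - riemann n a u) n + riemann 0 a u).
    apply/funext => n; rewrite /series /= (telescope_sumr (fun k => riemann k a
      u)) //.
    by rewrite subrK.
  by apply: is_cvgD => //; exact: is_cvg_cst.
exists (fun u => limn (fun n => riemann n a u)) => u v au uv vb.
have cu := cvgL _ au (le_trans uv vb); have cv := cvgL _ (le_trans au uv) vb.
set B := sewing_const theta * _ * _.
have lim1 : `|riemann n a v - riemann n a u - Xi u v| @[n --> \oo] -->
    `|limn (fun n => riemann n a v) - limn (fun n => riemann n a u) - Xi u v|.
  by apply: cvg_norm; apply: cvgB; [exact: cvgB|exact: cvg_cst].
have lim2 : B + geometric (M * (b - a) `^ theta) r n @[n --> \oo] --> B.
  rewrite -[X in _ --> X]addr0; apply: cvgD; [exact: cvg_cst|].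
  exact: cvg_geometric.
apply: ler_cvg_to lim1 lim2 _; near=> n.
have -> : riemann n a v - riemann n a u - Xi u v =
  (riemann n u v - Xi u v) + (riemann n a v - riemann n a u - riemann n u v).
  by ring.
by apply: (le_trans (ler_normD _ _)); apply: lerD;
  [exact: riemann_local|exact: riemann_additive].
Unshelve. all: end_near. Qed.

End sewing_map.

(** * Young integrals along Hoelder paths *)

Section young.
Context {R : realType}.
Implicit Types (f g : R -> R) (a b u v : R).

Definition holder_on gamma C a b f := forall u v,
  a <= u -> u <= v -> v <= b -> `|f v - f u| <= C * (v - u) `^ gamma.

Lemma uniform_partition a b n : a < b -> exists s,
  [/\ itv_partition a b s, size s = n.+1 &
   forall i, (i <= n.+1)%N ->
     partition_node a b s i = a + (b - a) * (i%:R / n.+1%:R)].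
Proof.
move=> ab; pose s := [seq a + (b - a) * (i.+1%:R / n.+1%:R) | i <- iota 0 n.+1].
have szs : size s = n.+1 by rewrite size_map size_iota.
have nodeE i : (i <= n.+1)%N ->
    nth b (a :: s) i = a + (b - a) * (i%:R / n.+1%:R).
  case: i => [|i] ni /=; first by rewrite mul0r mulr0 addr0.
  by rewrite (nth_map 0%N) ?size_iota // nth_iota.
exists s; split=> //; split.
  apply/(pathP b) => i; rewrite szs => ni.
  rewrite -[nth b s i]/(nth b (a :: s) i.+1) !nodeE //; last exact: ltnW.
  by rewrite ltrD2l ltr_pM2l ?subr_gt0 // ltr_pM2r ?invr_gt0 ?ltr0n // ltr_nat.
by rewrite (last_nth b) szs nodeE // divff ?pnatr_eq0 //; apply/eqP; ring.
Qed.

(** Fine partitions exist, hence the Young integral is unique. *)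
Lemma exists_fine_partition a b delta : a <= b -> 0 < delta ->
  exists s, itv_partition a b s /\ partition_mesh_lt delta a b s.
Proof.
rewrite le_eqVlt => /predU1P[<-|ab] d0; first by exists [::]; split => //;
  split.
pose n := Num.truncn ((b - a) / delta).
have [s [ps szs nodeE]] := uniform_partition n ab.
exists s; split=> // i; rewrite szs => ni.
rewrite !nodeE //; last exact: ltnW.
have -> : a + (b - a) * (i.+1%:R / n.+1%:R) - (a + (b - a) * (i%:R / n.+1%:R))
    = (b - a) / n.+1%:R by rewrite -natr1; field; rewrite nat1r pnatr_eq0.
rewrite ltr_pdivrMr ?ltr0n // mulrC -ltr_pdivrMr //.
exact: truncnS_gt.
Qed.

Lemma partition_node_mono a b s i : itv_partition a b s -> (i < size s)%N ->
  [/\ a <= partition_node a b s i, partition_node a b s i <= partition_node a b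
    s i.+1
    & partition_node a b s i.+1 <= b].
Proof.
move=> ps si; split.
- by apply: itv_partition_nth_ge => //; rewrite ltnS ltnW.
- by case: ps => /(pathP b)/(_ _ si)/ltW.
- exact: itv_partition_nth_le.
Qed.

Lemma young_integralE f g a b l : a <= b -> is_young_integral f g a b l ->
  young_integral f g a b = l.
Proof.
move=> ab fgl; have : is_young_integral f g a b (young_integral f g a b).
  by apply: getPex; exists l.
move: (young_integral f g a b) => l' fgl'.
apply/eqP; rewrite -subr_eq0 -normr_eq0; apply/negPn/negP => ne0.
have e0 : 0 < `|l' - l| / 2 by rewrite divr_gt0 // lt_neqAle eq_sym ne0
  normr_ge0.
have [d1 d10 H1] := fgl _ e0; have [d2 d20 H2] := fgl' _ e0.
have [s [ps ms]] := @exists_fine_partition a b (Num.min d1 d2) ab ltac:(by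
  rewrite lt_min d10).
pose xi := partition_node a b s.
have tags : partition_tags a b s xi.
  by move=> i /(partition_node_mono ps)[_ h _]; rewrite lexx h.
have {}H1 : `|stieltjes_sum f g a b s xi - l| < `|l' - l| / 2.
  by apply: H1 => // i /ms; rewrite lt_min => /andP[].
have {}H2 : `|stieltjes_sum f g a b s xi - l'| < `|l' - l| / 2.
  by apply: H2 => // i /ms; rewrite lt_min => /andP[].
have := ler_distD (stieltjes_sum f g a b s xi) l' l.
rewrite (distrC l' (stieltjes_sum _ _ _ _ _ _)); lra.
Qed.

(** Sewing applied to f u * (g v - g u), whose defect is
    (f u - f v) * (g w - g v). Each cell of a tagged Riemann sum then differs
    from the increment of Phi by a multiple of its length to the power
    2 gamma > 1, whatever the tag. *)
Lemma young_integral_exists f g a b gamma A C : a <= b -> 2^-1 < gamma ->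
  0 <= A -> 0 <= C -> holder_on gamma A a b f -> holder_on gamma C a b g ->
  exists Phi : R -> R, forall u v, a <= u -> u <= v -> v <= b ->
    is_young_integral f g u v (Phi v - Phi u) /\
    `|Phi v - Phi u - f u * (g v - g u)| <=
      sewing_const (2 * gamma) * (A * C) * (v - u) `^ (2 * gamma).
Proof.
move=> ab hg A0 C0 hf hgg.
have th1 : 1 < 2 * gamma by lra.
have AC0 : 0 <= A * C by rewrite mulr_ge0.
have g0 : 0 <= gamma by lra.
have K0 := @sewing_const_ge0 R _ th1.
have powM x : 0 <= x -> x `^ gamma * x `^ gamma = x `^ (2 * gamma).
  move=> x0; rewrite -powRD; first by congr (_ `^ _); ring.
  by apply/implyP => /eqP ?; exfalso; lra.
have cross u v w z : a <= u -> u <= v -> v <= b -> u <= z -> z <= w -> w <= v ->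
    forall y, u <= y -> y <= v ->
    `|(f y - f u) * (g w - g z)| <= A * C * (v - u) `^ (2 * gamma).
  move=> au uv vb uz zw wv y uy yv; rewrite normrM -powM ?subr_ge0 //.
  rewrite mulrACA; apply: ler_pM => //.
    apply: (le_trans (hf _ _ au uy (le_trans yv vb))).
    by rewrite ler_wpM2l // ler_powR_r // ?subr_ge0 // lerD2r.
  apply: (le_trans (hgg _ _ (le_trans au uz) zw (le_trans wv vb))).
  by rewrite ler_wpM2l // ler_powR_r // ?subr_ge0 //; lra.
have defect u v w : a <= u -> u <= v -> v <= w -> w <= b ->
    `|f u * (g w - g u) - f u * (g v - g u) - f v * (g w - g v)| <=
      A * C * (w - u) `^ (2 * gamma).
  move=> au uv vw wb.
  have -> : f u * (g w - g u) - f u * (g v - g u) - f v * (g w - g v) =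
    - ((f v - f u) * (g w - g v)) by ring.
  by rewrite normrN; apply: cross => //; exact: le_trans vw.
have [Phi PhiP] := @sewing R (fun u v => f u * (g v - g u)) _ _ _ _ ab AC0 th1
  defect.
exists Phi => u v au uv vb; split; last exact: PhiP.
pose K : R := A * C + sewing_const (2 * gamma) * (A * C).
have K'0 : 0 <= K by rewrite addr_ge0 // mulr_ge0.
move=> eps eps0.
pose D : R := K * (v - u) + 1.
have D0 : 0 < D by rewrite ltr_wpDl // mulr_ge0 // subr_ge0.
(* The mesh delta for which K (v - u) delta^(2 gamma - 1) < eps. *)
exists ((eps / D) `^ (2 * gamma - 1)^-1); first by rewrite powR_gt0 // divr_gt0.
move=> s xi ps ms ts.
set delta := _ `^ _ in ms.
have deltaE : delta `^ (2 * gamma - 1) = eps / D.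
  rewrite /delta -powRrM mulVf ?powRr1 ?divr_ge0 // ?ltW //.
  by rewrite gt_eqF //; lra.
have node0 : partition_node u v s 0 = u by [].
have nodel : partition_node u v s (size s) = v.
  exact: itv_partition_nth_size.
rewrite -[in Phi v]nodel -[in Phi u]node0.
rewrite -(telescope_sumr (fun i => Phi (partition_node u v s i)) (leq0n _)).
rewrite /stieltjes_sum -sumrB.
apply: (@le_lt_trans _ _ (\sum_(0 <= i < size s) K *
   (partition_node u v s i.+1 - partition_node u v s i) `^ (2 * gamma))).
  apply: (le_trans (ler_norm_sum _ _ _)).
  rewrite big_nat [leRHS]big_nat; apply: ler_sum => i /andP[_ si].
  have [n1 n2 n3] := partition_node_mono ps si.
  have /andP[t1 t2] := ts _ si.
  move: (partition_node u v s i) (partition_node u v s i.+1) (xi i) n1 n2 n3 t1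
    t2
    => p q y up pq qv py yq.
  have ap := le_trans au up; have qb := le_trans qv vb.
  have -> : f y * (g q - g p) - (Phi q - Phi p) =
    (f y - f p) * (g q - g p) - (Phi q - Phi p - f p * (g q - g p)) by ring.
  rewrite /K [leRHS]mulrDl; apply: (le_trans (ler_normB _ _)); apply: lerD.
    exact: cross.
  exact: PhiP.
rewrite -mulr_sumr.
apply: (@le_lt_trans _ _ (K * (delta `^ (2 * gamma - 1) * (v - u)))).
  apply: ler_wpM2l => //.
  have -> : v - u = partition_node u v s (size s) - partition_node u v s 0.
    by rewrite nodel.
  apply: (@sum_powR_mesh _ (partition_node u v s)) => // i si.
  have [_ ? _] := partition_node_mono ps si.
  by rewrite subr_ge0; apply/andP; split => //; exact/ltW/ms.
rewrite deltaE.
have -> : K * (eps / D * (v - u)) = eps * ((K * (v - u)) / D) by ring.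
by rewrite gtr_pMr // ltr_pdivrMr // mul1r /D ltrDl.
Qed.

End young.

(** * Signatures and their grid approximations *)

Section signature_paths.
Context {R : realType} (d : nat).
Implicit Types (X : 'I_d -> R -> R) (I : seq 'I_d).

Lemma signature_rcons X I i s u :
  signature X (rcons I i) s u = young_integral (signature X I s) (X i) s u.
Proof. by rewrite /signature foldl_rcons. Qed.

(** Iterated left-point sums: the indices are strictly increasing, as are the
    times in the iterated integrals. *)
Definition discrete_signature (g : 'I_d -> nat -> R) I (l : nat) : R :=
  foldl (fun (F : nat -> R) i l => \sum_(0 <= j < l) F j * (g i j.+1 - g i j))
    (fun=> 1) I l.

Lemma discrete_signature_rcons g I i l :
  discrete_signature g (rcons I i) l =
  \sum_(0 <= j < l) discrete_signature g I j * (g i j.+1 - g i j).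
Proof. by rewrite /discrete_signature foldl_rcons. Qed.

Lemma young_integral_diag (f g : R -> R) a : young_integral f g a a = 0.
Proof.
apply: young_integralE => // eps eps0; exists 1 => // s xi /itv_partitionxx ->
  _ _.
by rewrite /stieltjes_sum big_geq // subrr normr0.
Qed.

Lemma signature_diag X I s : signature X I s s = (size I == 0%N)%:R.
Proof.
case/lastP: I => [//|I i].
by rewrite signature_rcons young_integral_diag size_rcons.
Qed.

Lemma discrete_signature0 g I : discrete_signature g I 0 = (size I == 0%N)%:R.
Proof.
case/lastP: I => [//|I i].
by rewrite discrete_signature_rcons big_geq // size_rcons.
Qed.

Definition grid (s t : R) N (l : nat) : R := s + l%:R * ((t - s) / N.+1%:R).

Definition grid_signature X I s t N l :=
  discrete_signature (fun i l => X i (grid s t N l)) I l.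

Section pathwise.
Variables (X : 'I_d -> R -> R) (s t gamma : R).
Hypotheses (st : s <= t) (hg : 2^-1 < gamma) (hg1 : gamma <= 1)
  (hX : forall i, exists2 C, 0 <= C & holder_on gamma C s t (X i)).

Let g0 : 0 <= gamma. Proof. by move: hg => h; lra. Qed.

Let th1 : 1 < 2 * gamma. Proof. by move: hg => h; lra. Qed.

Let pow2_le x : 0 <= x -> x <= t - s -> x `^ (2 * gamma) <= (t - s) `^ gamma *
  x `^ gamma.
Proof.
move=> x0 xt; have -> : 2 * gamma = gamma + gamma by ring.
rewrite powRD; last by apply/implyP => /eqP ?; exfalso; move: hg => h; lra.
by rewrite ler_wpM2r ?powR_ge0 // ler_powR_r.
Qed.

(** Induction on the length: the increment of the next iterated integral over
    [u, v] is S_I(u) (X v - X u) up to an error of order (v - u)^(2 gamma). *)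
Lemma signature_holder I :
  exists2 C, 0 <= C & holder_on gamma C s t (signature X I s).
Proof.
elim/last_ind: I => [|I i [A A0 hA]].
  by exists 0 => // u v _ _ _; rewrite subrr normr0 mul0r.
have [C C0 hC] := hX i.
have [Phi PhiP] := young_integral_exists st hg A0 C0 hA hC.
have sigE u : s <= u -> u <= t -> signature X (rcons I i) s u = Phi u - Phi s.
  move=> su ut; rewrite signature_rcons; apply: young_integralE => //.
  by have [] := PhiP s u (lexx _) su ut.
pose B : R := 1 + A * (t - s) `^ gamma.
have Bsig u : s <= u -> u <= t -> `|signature X I s u| <= B.
  move=> su ut; have := hA s u (lexx _) su ut.
  have := ler_normD (signature X I s u - signature X I s s) (signature X I s s).
  rewrite subrK => h1 h2; apply: (le_trans h1); rewrite /B addrC; apply: lerD.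
    by rewrite signature_diag normr_nat -[leRHS]/(1%:R) ler_nat; case: eqP.
  apply: (le_trans h2); rewrite ler_wpM2l // ler_powR_r // ?subr_ge0 //; lra.
have B0 : 0 <= B by rewrite addr_ge0 // mulr_ge0 ?powR_ge0.
have K0 : 0 <= sewing_const (2 * gamma) * (A * C).
  by rewrite mulr_ge0 ?sewing_const_ge0 ?mulr_ge0.
exists (B * C + sewing_const (2 * gamma) * (A * C) * (t - s) `^ gamma).
  by rewrite addr_ge0 // mulr_ge0 // powR_ge0.
move=> u v su uv vt; have sv := le_trans su uv; have ut := le_trans uv vt.
rewrite !sigE //; have [_ h] := PhiP u v su uv vt.
have -> : Phi v - Phi s - (Phi u - Phi s) = signature X I s u * (X i v - X i u)
  +
  (Phi v - Phi u - signature X I s u * (X i v - X i u)) by ring.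
apply: (le_trans (ler_normD _ _)); rewrite mulrDl; apply: lerD.
  by rewrite normrM -mulrA; apply: ler_pM => //; [exact: Bsig|exact: hC].
apply: (le_trans h); rewrite -[leRHS]mulrA ler_wpM2l //.
by apply: pow2_le; lra.
Qed.

Let err I N l :=
  signature X I s (grid s t N l) - grid_signature X I s t N l.

(** The Hoelder constant of the error decreases like h^(2 gamma - 1), where h is
    the mesh. In the inductive step the error splits into the local errors of
    the Young integral, which add up to h^(2 gamma - 1) times the length, and
    the discrete integral of the previous error, to which [discrete_sewing]
    applies because that error is itself Hoelder with exponent gamma. *)
Lemma grid_signature_error I : exists2 C, 0 <= C &
  forall N j k, (j <= k)%N -> (k <= N.+1)%N ->
  `|err I N k - err I N j| <= C * ((t - s) / N.+1%:R) `^ (2 * gamma - 1) *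
     (grid s t N k - grid s t N j) `^ gamma.
Proof.
elim/last_ind: I => [|I i [A A0 hA]].
  exists 0 => // N j k _ _.
  by rewrite /err /signature /grid_signature /discrete_signature /= !subrr
    normr0 !mul0r.
have [C C0 hC] := hX i.
have [B B0 hB] := signature_holder I.
have [Phi PhiP] := young_integral_exists st hg B0 C0 hB hC.
have sigE u : s <= u -> u <= t -> signature X (rcons I i) s u = Phi u - Phi s.
  move=> su ut; rewrite signature_rcons; apply: young_integralE => //.
  by have [] := PhiP s u (lexx _) su ut.
have K0 := sewing_const_ge0 th1.
pose K := sewing_const (2 * gamma).
exists (K * (B * C) * (t - s) `^ (1 - gamma) + K * (A * C) * (t - s) `^ gamma
   + A * (t - s) `^ gamma * C).
  by do ?[exact: K0 | exact: A0 | exact: B0 | exact: C0 | exact: powR_ge0 |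
    apply: addr_ge0 | apply: mulr_ge0].
move=> N j k jk kN; have {}hA := hA N.
set h := (t - s) / N.+1%:R in hA *; pose x l := grid s t N l.
pose D l := err I N l.
have h0 : 0 <= h by rewrite divr_ge0 // subr_ge0.
have xS l : x l.+1 - x l = h by rewrite /x /grid -/h -natr1; ring.
have x_homo : {homo x : i j / (i <= j)%N >-> i <= j}.
  by move=> l m lm; rewrite /x /grid -/h lerD2l ler_wpM2r // ler_nat.
have x0 : x 0%N = s by rewrite /x /grid mul0r addr0.
have xN : x N.+1 = t by rewrite /x /grid mulrCA divff ?pnatr_eq0 // mulr1; ring.
have sx l : s <= x l by rewrite -x0 x_homo.
have xt l : (l <= N.+1)%N -> x l <= t by rewrite -xN; exact: x_homo.
rewrite /err /grid_signature !sigE ?xt //; last exact: leq_trans kN.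
rewrite !discrete_signature_rcons (big_cat_nat (n := j) (p := k)) //=.
set S := \sum_(j <= _ < k) _; set S0 := \sum_(_ <= _ < _) _.
have -> : Phi (grid s t N k) - Phi s - (S0 + S) - (Phi (grid s t N j) - Phi s -
  S0) =
    Phi (x k) - Phi (x j) - S.
  by rewrite -/(x k) -/(x j); ring.
pose D1 := \sum_(j <= l < k) (Phi (x l.+1) - Phi (x l) -
   signature X I s (x l) * (X i (x l.+1) - X i (x l))).
pose Xi l m := D l * (X i (x m) - X i (x l)).
have -> : Phi (x k) - Phi (x j) - S = D1 + (\sum_(j <= l < k) Xi l l.+1 - Xi j
  k)
    + Xi j k.
  rewrite -[RHS]addrA subrK /D1 -big_split /= -(telescope_sumr (Phi \o x) jk)
    /S -sumrB.
  by apply: eq_bigr => l _ /=; rewrite /Xi /D /err /grid_signature -/(x l);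
    ring.
have Lkj : 0 <= x k - x j by rewrite subr_ge0 x_homo.
have Lts : x k - x j <= t - s by have := sx j; have := xt _ kN; lra.
have Dbound : `|D j| <= A * h `^ (2 * gamma - 1) * (t - s) `^ gamma.
  have D0 : D 0%N = 0.
    by rewrite /D /err /grid_signature -/(x 0%N) x0 signature_diag
      discrete_signature0 subrr.
  have := hA 0%N j (leq0n _) (leq_trans jk kN).
  rewrite -/(D 0%N) -/(D j) D0 subr0 => Dj.
  apply: (le_trans Dj); rewrite ler_wpM2l ?mulr_ge0 ?powR_ge0 //.
  rewrite -/(x j) -/(x 0%N) x0 ler_powR_r // ?subr_ge0 // lerB //.
  by rewrite xt // (leq_trans jk).
have distr (y1 y2 y3 y z : R) : (y1 + y2 + y3) * y * z =
  y1 * z * y + y2 * z * y + y3 * z * y by ring.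
rewrite distr; apply: (le_trans (ler_normD _ _)); apply: lerD.
  apply: (le_trans (ler_normD _ _)); apply: lerD.
    apply: (le_trans (ler_norm_sum _ _ _)).
    apply: (@le_trans _ _ (\sum_(j <= l < k) K * (B * C) * h `^ (2 * gamma))).
      rewrite big_nat [leRHS]big_nat; apply: ler_sum => l /andP[jl lk].
      rewrite -(xS l).
      have := PhiP (x l) (x l.+1) (sx l) (x_homo _ _ (leqnSn l)) (xt _
        (leq_trans lk kN)).
      by case.
    have KBC0 : 0 <= K * (B * C) by apply: mulr_ge0;
      [exact: K0|exact: mulr_ge0].
    rewrite sumr_const_nat -[leLHS]mulr_natr -mulrA.
    rewrite -[leRHS]mulrA -[leRHS]mulrA ler_wpM2l //.
    have -> : h `^ (2 * gamma) = h * h `^ (2 * gamma - 1).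
      by rewrite mulr_powRB1 //; move: th1 => ?; lra.
    have -> : h * h `^ (2 * gamma - 1) * (k - j)%:R = (x k - x j) * h `^ (2 *
      gamma - 1).
      by rewrite natrB // /x /grid -/h; ring.
     rewrite [leRHS]mulrA ler_wpM2r ?powR_ge0 //.
    have [->|L0] := eqVneq (x k - x j) 0; first by rewrite mulr_ge0 ?powR_ge0.
    have {1}-> : x k - x j = (x k - x j) `^ (1 - gamma) * (x k - x j) `^ gamma.
      by rewrite -powRD ?L0 ?implybT // subrK powRr1.
    by rewrite ler_wpM2r ?powR_ge0 // ler_powR_r // subr_ge0.
  have AC0 : 0 <= A * h `^ (2 * gamma - 1) * C by rewrite !mulr_ge0 ?powR_ge0.
  have KAC0 : 0 <= K * (A * h `^ (2 * gamma - 1) * C) by apply: mulr_ge0;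
    [exact: K0|].
  apply: (@le_trans _ _ (K * (A * h `^ (2 * gamma - 1) * C) *
      (x k - x j) `^ (2 * gamma))).
    apply: (discrete_sewing (n := N.+1)) => //.
    - by move=> l _; exact: x_homo.
    - by move=> l _; rewrite /Xi subrr mulr0.
    move=> l m n lm mn nN.
    have -> : Xi l n - Xi l m - Xi m n = - ((D m - D l) * (X i (x n) - X i (x
      m))).
      by rewrite /Xi; ring.
    have xln : 0 <= x n - x l by rewrite subr_ge0 x_homo // (leq_trans lm).
    have -> : (x n - x l) `^ (2 * gamma) = (x n - x l) `^ gamma * (x n - x l)
      `^ gamma.
      rewrite -powRD; first by congr (_ `^ _); ring.
      by apply/implyP => /eqP ?; exfalso; move: hg => ?; lra.
    rewrite normrN normrM mulrACA; apply: ler_pM => //.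
      apply: (le_trans (hA l m lm (leq_trans mn nN))).
      rewrite ler_wpM2l ?mulr_ge0 ?powR_ge0 // ler_powR_r // ?subr_ge0 ?x_homo
        //.
      by rewrite lerB // x_homo.
    apply: (le_trans (hC _ _ (sx m) (x_homo _ _ mn) (xt _ nN))).
    rewrite ler_wpM2l // ler_powR_r // ?subr_ge0 ?x_homo //.
    by rewrite lerB // x_homo.
  have -> : K * (A * C) * (t - s) `^ gamma * (x k - x j) `^ gamma * h `^ (2 *
    gamma - 1) =
     K * (A * h `^ (2 * gamma - 1) * C) * ((t - s) `^ gamma * (x k - x j) `^
       gamma) by ring.
  by rewrite ler_wpM2l // pow2_le.
rewrite normrM.
have -> : A * (t - s) `^ gamma * C * (x k - x j) `^ gamma * h `^ (2 * gamma -
  1) =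
  (A * h `^ (2 * gamma - 1) * (t - s) `^ gamma) * (C * (x k - x j) `^ gamma) by
    ring.
by apply: ler_pM => //; apply: hC; rewrite ?x_homo ?xt.
Qed.

Lemma cvg_grid_signature I :
  grid_signature X I s t N N.+1 @[N --> \oo] --> signature X I s t.
Proof.
have [C C0 hC] := grid_signature_error I.
have xN N : grid s t N N.+1 = t by rewrite /grid mulrCA divff ?pnatr_eq0 //
  mulr1; ring.
have x0 N : grid s t N 0 = s by rewrite /grid mul0r addr0.
apply/cvgrPdist_le => /= eps eps0.
pose K := C * (t - s) `^ gamma + 1.
have K0 : 0 < K by rewrite ltr_wpDl // mulr_ge0 // powR_ge0.
pose e := (eps / K) `^ (2 * gamma - 1)^-1.
have e0 : 0 < e by rewrite powR_gt0 // divr_gt0.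
near=> N.
have hN : (t - s) / N.+1%:R <= e.
  rewrite ler_pdivrMr // mulrC -ler_pdivrMr //.
  apply: (@le_trans _ _ N%:R); last by rewrite ler_nat.
  by near: N; exact: nbhs_infty_ger.
have := hC N 0%N N.+1 (leq0n _) (leqnn _).
have -> : err I N 0 = 0.
  by rewrite /err /grid_signature x0 signature_diag discrete_signature0 subrr.
rewrite subr0 /err xN x0 => h; apply: (le_trans h).
apply: (@le_trans _ _ (C * (eps / K) * (t - s) `^ gamma)).
  rewrite ler_wpM2r ?powR_ge0 // ler_wpM2l //.
  have -> : eps / K = e `^ (2 * gamma - 1).
    rewrite -powRrM mulVf ?powRr1 ?divr_ge0 // ?ltW //.
    by rewrite gt_eqF //; move: th1 => ?; lra.
  rewrite ler_powR_r ?divr_ge0 ?subr_ge0 //; move: th1 => ?; lra.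
have -> : C * (eps / K) * (t - s) `^ gamma = eps * ((C * (t - s) `^ gamma) / K)
  by ring.
by rewrite ger_pMr // ler_pdivrMr // mul1r /K lerDl.
Unshelve. all: end_near. Qed.

End pathwise.
End signature_paths.

(** * Polarization *)

Section polarization.
Context {R : comPzRingType}.

Definition subset_sign n (S : {set 'I_n}) : R :=
  \prod_(a < n) (if a \in S then 1 else -1).

(** Inclusion-exclusion: the sum factors as the product over a of
    1 - [a \notin U]. The sign (-1)^(n - #|S|) is encoded as a product over the
    points for this purpose. *)
Lemma subset_sign_sum n (U : {set 'I_n}) :
  \sum_(S : {set 'I_n}) subset_sign S * (U \subset S)%:R =
  (U == [set: 'I_n]%SET)%:R.
Proof.
transitivity (\prod_(a < n) (1 + - (a \notin U)%:R) : R).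
  rewrite bigA_distr; apply: eq_bigr => S _.
  rewrite /subset_sign; have [US|nUS] := boolP (U \subset S).
    rewrite mulr1; apply: eq_bigr => a _; case: ifPn => // aS.
    by rewrite (contraNN (fintype.subsetP US a)).
  have [a aU aS] := subsetPn nUS.
  by rewrite mulr0 (bigD1 a) //= (negbTE aS) aU /= oppr0 mul0r.
have [->|nT] := eqVneq.
  by apply: big1 => a _; rewrite inE subr0.
have [a aU] : exists a, a \notin U.
  apply/existsP; apply: contraNT nT; rewrite negb_exists => /forallP h.
  by apply/eqP/setP => a; rewrite inE; have := h a; rewrite negbK.
by rewrite (bigD1 a) //= aU subrr mul0r.
Qed.

(** Expanding the power over functions f from 'I_m to T, the alternating sum
    keeps those whose supports cover all n points. It is used twice: with
    singletons as supports, where it is the polarization identity, and with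
    pairs, where it evaluates the moments of a Gaussian family. *)
Lemma polarization n m (T : finType) (supp : T -> {set 'I_n}) (y : T -> R) :
  \sum_(S : {set 'I_n}) subset_sign S * (\sum_(t | supp t \subset S) y t) ^+ m =
  \sum_(f : {ffun 'I_m -> T}) (\prod_(l < m) y (f l)) *
     ((\bigcup_(l < m) supp (f l))%SET == [set: 'I_n]%SET)%:R.
Proof.
transitivity (\sum_(S : {set 'I_n}) \sum_(f : {ffun 'I_m -> T})
    (\prod_(l < m) y (f l)) *
    (subset_sign S * ((\bigcup_(l < m) supp (f l))%SET \subset S)%:R)).
  apply: eq_bigr => S _; rewrite -[X in _ ^+ X]card_ord -prodr_const.
  under eq_bigr do rewrite big_mkcond.
  rewrite bigA_distr_bigA mulr_sumr; apply: eq_bigr => f _ /=.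
  rewrite mulrCA; congr (_ * _).
  have [US|] := boolP (_ \subset S).
    rewrite mulr1; apply: eq_bigr => l _; rewrite ifT //.
    by apply: fintype.subset_trans US; exact: (finset.bigcup_sup l (P :=
      xpredT)).
  move=> /finset.bigcupsP nUS; rewrite mulr0.
  have [l nl] : exists l, ~~ (supp (f l) \subset S).
    apply/existsP; rewrite -negb_forall; apply/negP => /forallP h.
    by apply: nUS => l _; exact: h.
  by rewrite (bigD1 l) //= (negbTE nl) mul0r.
rewrite exchange_big /=; apply: eq_bigr => f _.
by rewrite -mulr_sumr subset_sign_sum.
Qed.

Lemma polarization_prod n (x : 'I_n -> R) :
  \sum_(S : {set 'I_n}) subset_sign S * (\sum_(a in S) x a) ^+ n =
  (\prod_(a < n) x a) *+ n`!.
Proof.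
have := polarization n (fun a : 'I_n => finset.set1 a) x.
under eq_bigr do under eq_bigl do rewrite finset.sub1set.
move=> ->.
rewrite [LHS](bigID (fun f : {ffun 'I_n -> 'I_n} => injectiveb f)) /=.
rewrite [X in _ + X]big1 ?addr0; last first.
  move=> f; move=> /negP nf; rewrite [(_ == _)](_ : _ = false) ?mulr0 //.
  apply/negP => /eqP fT; apply: nf; apply/injectiveP.
  have surj a : exists l, f l = a.
    have : a \in (\bigcup_(l < n) [set f l])%SET by rewrite fT inE.
    by case/finset.bigcupP => l _; rewrite inE => /eqP ->; exists l.
  have [g gK] := fin_all_exists surj.
  have gbij : bijective g by apply: injF_bij; exact: can_inj gK.
  exact/bij_inj/(bij_can_bij gbij).
transitivity (\sum_(f : {ffun 'I_n -> 'I_n} | injectiveb f) \prod_(a < n) x a).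
  apply: eq_bigr => f /injectiveP fI.
  rewrite [(_ == _)](_ : _ = true); last first.
    apply/eqP/setP => a; rewrite inE; apply/finset.bigcupP.
    have [g _ gK] := injF_bij fI.
    by exists (g a) => //; rewrite inE gK.
  by rewrite mulr1 [RHS](reindex_inj fI).
rewrite sumr_const -cardsE card_inj_ffuns card_ord ffactnn //.
Qed.

End polarization.

(** * Isserlis formula *)

Section moments.
Context {disp : measure_display} {Omega : measurableType disp} {R : realType}.
Variable P : probability Omega R.
Implicit Types Y Z : Omega -> R.

(** A class of random variables stable under sums and products, in which the
    mean is linear. *)
Definition has_moments Y := measurable_fun setT Y /\
  forall n, P.-integrable setT (EFin \o (fun w => `|Y w| ^+ n)).

Definition mean Y : R := (\int[P]_w Y w)%R.

Lemma integrable_bound Y Z : measurable_fun setT Y ->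
  P.-integrable setT (EFin \o Z) -> (forall w, `|Y w| <= Z w) ->
  P.-integrable setT (EFin \o Y).
Proof.
move=> mY iZ YZ; apply: le_integrable iZ => //; first exact/measurable_EFinP.
by move=> w _ /=; rewrite lee_fin (le_trans (YZ w)) // ler_norm.
Qed.

Lemma has_moments_integrable Y : has_moments Y -> P.-integrable setT (EFin \o
  Y).
Proof.
by move=> [mY /(_ 1%N) iY]; apply: integrable_bound iY _ => // w; rewrite expr1.
Qed.

Lemma has_moments_cst (c : R) : has_moments (fun=> c).
Proof.
by split => // n; exact: finite_measure_integrable_cst.
Qed.

Lemma has_momentsD Y Z : has_moments Y -> has_moments Z ->
  has_moments (fun w => Y w + Z w).
Proof.
move=> [mY iY] [mZ iZ]; split; first exact: measurable_funD.
move=> n; apply: (@integrable_bound _ (fun w => 2 ^+ n * (`|Y w| ^+ n + `|Z w|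
  ^+ n))).
- apply/measurable_funX; apply: measurableT_comp => //; exact: measurable_funD.
- have := integrableZl measurableT (2 ^+ n) (integrableD measurableT (iY n) (iZ
  n)).
  by apply: eq_integrable => // w _ /=; rewrite EFinM EFinD.
move=> w; rewrite ger0_norm ?exprn_ge0 //.
have [yz|/ltW zy] := leP `|Y w| `|Z w|.
  apply: (@le_trans _ _ ((2 * `|Z w|) ^+ n)).
    rewrite lerXn2r ?nnegrE ?mulr_ge0 // (le_trans (ler_normD _ _)) //; lra.
  by rewrite exprMn ler_wpM2l ?exprn_ge0 // lerDr exprn_ge0.
apply: (@le_trans _ _ ((2 * `|Y w|) ^+ n)).
  rewrite lerXn2r ?nnegrE ?mulr_ge0 // (le_trans (ler_normD _ _)) //; lra.
by rewrite exprMn ler_wpM2l ?exprn_ge0 // lerDl exprn_ge0.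
Qed.

Lemma has_momentsM Y Z : has_moments Y -> has_moments Z ->
  has_moments (fun w => Y w * Z w).
Proof.
move=> [mY iY] [mZ iZ]; split; first exact: measurable_funM.
move=> n; apply: (@integrable_bound _ (fun w => `|Y w| ^+ (n * 2) + `|Z w| ^+
  (n * 2))).
- apply/measurable_funX; apply: measurableT_comp => //; exact: measurable_funM.
- have := integrableD measurableT (iY (n * 2)%N) (iZ (n * 2)%N).
  by apply: eq_integrable => // w _ /=; rewrite EFinD.
move=> w; rewrite ger0_norm ?exprn_ge0 // normrM exprMn !exprM.
have : 0 <= `|Y w| ^+ n by exact: exprn_ge0.
have : 0 <= `|Z w| ^+ n by exact: exprn_ge0.
by move: (_ ^+ n) (_ ^+ n) => a b; nra.
Qed.

Lemma has_momentsZ (c : R) Y : has_moments Y -> has_moments (fun w => c * Y w).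
Proof. by move=> hY; apply: has_momentsM => //; exact: has_moments_cst. Qed.

Lemma has_moments_sum (T : Type) (r : seq T) (Q : pred T) (F : T -> Omega -> R)
  :
  (forall a, has_moments (F a)) -> has_moments (fun w => \sum_(a <- r | Q a) F
    a w).
Proof.
move=> hF; elim: r => [|a r IH].
  by under eq_fun do rewrite big_nil; exact: has_moments_cst.
under eq_fun do rewrite big_cons; case: (Q a) => //; exact: has_momentsD.
Qed.

Lemma has_moments_prod (T : Type) (r : seq T) (F : T -> Omega -> R) :
  (forall a, has_moments (F a)) -> has_moments (fun w => \prod_(a <- r) F a w).
Proof.
move=> hF; elim: r => [|a r IH].
  by under eq_fun do rewrite big_nil; exact: has_moments_cst.
under eq_fun do rewrite big_cons; exact: has_momentsM.
Qed.

Lemma has_momentsX n Y : has_moments Y -> has_moments (fun w => Y w ^+ n).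
Proof.
move=> hY; elim: n => [|n IH]; first exact: has_moments_cst.
by under eq_fun do rewrite exprS; exact: has_momentsM.
Qed.

Lemma meanD Y Z : has_moments Y -> has_moments Z ->
  mean (fun w => Y w + Z w) = mean Y + mean Z.
Proof.
by move=> hY hZ; rewrite /mean RintegralD //; exact: has_moments_integrable.
Qed.

Lemma meanZ (c : R) Y : has_moments Y -> mean (fun w => c * Y w) = c * mean Y.
Proof.
by move=> hY; rewrite /mean RintegralZl //; exact: has_moments_integrable.
Qed.

Lemma mean_cst (c : R) : mean (fun=> c) = c.
Proof.
transitivity (c * fine (P setT)); first exact: Rintegral_cst.
by rewrite probability_setT mulr1.
Qed.

Lemma mean_sum (T : Type) (r : seq T) (Q : pred T) (F : T -> Omega -> R) :
  (forall a, has_moments (F a)) ->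
  mean (fun w => \sum_(a <- r | Q a) F a w) = \sum_(a <- r | Q a) mean (F a).
Proof.
move=> hF; elim: r => [|a r IH].
  by rewrite big_nil; under eq_fun do rewrite big_nil; exact: mean_cst.
rewrite big_cons; under eq_fun do rewrite big_cons; case: (Q a) => //.
by rewrite meanD ?IH //; exact: has_moments_sum.
Qed.

(* Gaussian families enter through one property: the moment of order 2k of a
   linear combination is a fixed multiple of the k-th power of its variance. *)
Section isserlis.
Variables (k : nat) (kappa : R) (X : 'I_(k * 2) -> Omega -> R).
Hypothesis (hX : forall a, has_moments (X a)).
Hypothesis (gX : forall c : 'I_(k * 2) -> R,
  mean (fun w => (\sum_a c a * X a w) ^+ (k * 2)) =
  kappa * mean (fun w => (\sum_a c a * X a w) ^+ 2) ^+ k).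

(** Isserlis' formula, summed over ordered families of k pairs that cover the
    indices, each pairing being counted several times. Polarization expresses
    the product by powers of partial sums, whose moments are powers of the
    quadratic form of covariances; polarizing back leaves the covering
    families. *)
Lemma isserlis :
  mean (fun w => \prod_a X a w) *+ (k * 2)`! =
  kappa * \sum_(f : {ffun 'I_k -> 'I_(k * 2) * 'I_(k * 2)})
   (\prod_(l < k) mean (fun w => X (f l).1 w * X (f l).2 w)) *
   ((\bigcup_(l < k) [set (f l).1; (f l).2])%SET == finset.setTfor 'I_(k *
     2))%:R.
Proof.
pose cov (p : 'I_(k * 2) * 'I_(k * 2)) := mean (fun w => X p.1 w * X p.2 w).
pose supp (p : 'I_(k * 2) * 'I_(k * 2)) := [set p.1; p.2]%SET.
rewrite -[X in kappa * X](polarization k supp cov) -mulr_natl -meanZ;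
  last first.
  exact: has_moments_prod.
have hS (S : {set 'I_(k * 2)}) : has_moments (fun w => \sum_(a in S) X a w).
  exact: has_moments_sum.
transitivity (mean (fun w => \sum_(S : {set 'I_(k * 2)})
    subset_sign S * (\sum_(a in S) X a w) ^+ (k * 2))).
  by congr mean; apply/funext => w; rewrite mulr_natl -polarization_prod.
rewrite mean_sum; last by move=> S; apply/has_momentsZ/has_momentsX.
rewrite mulr_sumr; apply: eq_bigr => S _; rewrite meanZ;
  last exact: has_momentsX.
rewrite mulrCA; congr (_ * _).
have E w : \sum_(a in S) X a w = \sum_a (a \in S)%:R * X a w.
  rewrite big_mkcond; apply: eq_bigr => a _.
  by case: (a \in S); rewrite ?mul1r ?mul0r.
under eq_fun do rewrite E.
rewrite gX; congr (_ * _ ^+ _).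
under eq_fun do rewrite -E.
transitivity (mean (fun w => \sum_(p | supp p \subset S) X p.1 w * X p.2 w)).
  congr mean; apply/funext => w; rewrite expr2 mulr_suml.
  under eq_bigr do rewrite mulr_sumr.
  rewrite pair_big /=; apply: eq_bigl => -[a b] /=.
  by rewrite /supp /= finset.subUset !finset.sub1set.
by apply: mean_sum => p; exact: has_momentsM.
Qed.

End isserlis.

(** The weights in Isserlis' formula are nonnegative and common to X and X', so
    that means of products are monotone in nonnegative covariances. *)
Lemma isserlis_le k kappa (X X' : 'I_(k * 2) -> Omega -> R) : 0 <= kappa ->
  (forall a, has_moments (X a)) -> (forall a, has_moments (X' a)) ->
  (forall c : 'I_(k * 2) -> R,
    mean (fun w => (\sum_a c a * X a w) ^+ (k * 2)) =
    kappa * mean (fun w => (\sum_a c a * X a w) ^+ 2) ^+ k) ->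
  (forall c : 'I_(k * 2) -> R,
    mean (fun w => (\sum_a c a * X' a w) ^+ (k * 2)) =
    kappa * mean (fun w => (\sum_a c a * X' a w) ^+ 2) ^+ k) ->
  (forall a b, 0 <= mean (fun w => X a w * X b w) <= mean (fun w => X' a w * X'
    b w)) ->
  0 <= mean (fun w => \prod_a X a w) <= mean (fun w => \prod_a X' a w).
Proof.
move=> kappa0 hX hX' gX gX' cov.
have fact0 : (0 < (k * 2)`!)%N by exact: fact_gt0.
apply/andP; split.
  rewrite -(pmulrn_lge0 _ fact0) (isserlis hX gX) mulr_ge0 // sumr_ge0 // => f
    _.
  by rewrite mulr_ge0 // prodr_ge0 // => l _;
    have /andP[] := cov (f l).1 (f l).2.
rewrite -(ler_pMn2r fact0) (isserlis hX gX) (isserlis hX' gX') ler_wpM2l //;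
  apply: ler_sum => f _.
by rewrite ler_wpM2r // ler_prod // => l _.
Qed.

End moments.

(** * Moments of the normal law *)

Section normal_law.
Context {R : realType}.
Local Notation mu := (@lebesgue_measure R).
Implicit Types (m s : R) (G : R -> R).

(** The density of [normal_prob] is its Radon-Nikodym derivative almost
    everywhere. *)
Lemma normal_prob_integral m s (f : R -> \bar R) : measurable_fun setT f ->
  (forall x, 0 <= f x)%E ->
  (\int[normal_prob m s]_x f x = \int[mu]_x (f x * (normal_pdf m s x)%:E))%E.
Proof.
move=> mf f0; have dom := normal_prob_dominates m s.
rewrite -(Radon_Nikodym_SigmaFinite.change_of_variables dom) //.
have mpdf : measurable_fun setT (fun x : measurableTypeR R => (normal_pdf m s
  x)%:E).
  by apply/measurable_EFinP; exact: measurable_normal_pdf.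
have RNi := Radon_Nikodym_SigmaFinite.f_integrable dom.
apply: ge0_ae_eq_integral => //.
- apply: emeasurable_funM => //; exact: measurable_int RNi.
- exact: emeasurable_funM.
- by move=> x _; rewrite mule_ge0 // Radon_Nikodym_SigmaFinite.f_ge0.
- by move=> x _; rewrite mule_ge0 // lee_fin normal_pdf_ge0.
apply: ae_eqe_mul2l.
apply: integral_ae_eq => //.
by move=> E _ mE; rewrite -Radon_Nikodym_SigmaFinite.f_integral.
Qed.

Lemma normal_peakE s : 0 < s -> normal_peak s = s^-1 * (Num.sqrt (pi *+ 2))^-1.
Proof.
move=> s0; rewrite /normal_peak -mulrnAr sqrtrM ?sqr_ge0 // sqrtr_sqr gtr0_norm
  //.
by rewrite invfM.
Qed.

Lemma normal_pdf_affine m s y : 0 < s ->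
  normal_pdf m s (m + s * y) * s = normal_pdf 0 1 y.
Proof.
move=> s0; rewrite !normal_pdfE ?gt_eqF // !normal_peakE // /normal_fun.
rewrite invr1 mul1r mulrC !mulrA mulfV ?gt_eqF // mul1r; congr (_ * expR _).
by field; rewrite gt_eqF.
Qed.

Lemma normal_prob_affine m s G : 0 < s -> continuous G -> (forall x, 0 <= G x)
  ->
  (\int[normal_prob m s]_x (G x)%:E =
   \int[normal_prob 0 1]_y (G (m + s * y))%:E)%E.
Proof.
move=> s0 cG G0.
have mG : measurable_fun setT G by exact: continuous_measurable_fun.
pose F (y : R) : R := m + s * y.
have dF y : derivable F y 1 by [].
have F'E : F^`()%classic = cst s.
  apply/funext => y; rewrite /F derive1E deriveD // derive_cst add0r.
  by rewrite deriveM // derive_cst scaler0 addr0 derive_id /GRing.scale /=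
    mulr1.
have cF : continuous F.
  by move=> y; apply: differentiable_continuous; exact/derivable1_diffP.
have mGF : measurable_fun setT (EFin \o (G \o F)).
  by apply/measurable_EFinP; apply: measurableT_comp => //;
    exact: continuous_measurable_fun.
rewrite (normal_prob_integral _ _ (f := EFin \o G)) /=; last 2 first.
- exact/measurable_EFinP.
- by move=> x; rewrite lee_fin.
rewrite (normal_prob_integral _ _ mGF) /=; last by move=> x; rewrite lee_fin.
rewrite (increasing_ge0_integration_by_substitutionT (F := F)
  (G := fun x => G x * normal_pdf m s x)).
- apply: eq_integral => y _; rewrite F'E /= -EFinM -(normal_pdf_affine m y s0).
  by rewrite /= !fctE /= mulrA.
- by move=> x y xy; rewrite /F ltrD2l ltr_pM2l.
- by rewrite F'E => ?; exact: cvg_cst.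
- by rewrite F'E; exact: is_cvg_cst.
- by rewrite F'E; exact: is_cvg_cst.
- exact: dF.
- rewrite /F; apply: (cvg_comp (fun y => s * y) (fun y => m + y)).
    exact/gt0_cvgMrNy.
  exact: cvg_addrl_Ny.
- rewrite /F; apply: (cvg_comp (fun y => s * y) (fun y => m + y)).
    exact/gt0_cvgMry.
  exact: cvg_addrl.
- move=> x; apply: cvgM; first exact: cG.
  by apply: continuous_normal_pdf; rewrite gt_eqF.
- by move=> x; rewrite mulr_ge0 // normal_pdf_ge0.
Qed.

Lemma std_normal_opp G : measurable_fun setT G -> (forall x, 0 <= G x) ->
  (\int[normal_prob 0 1]_y (G (- (y : R)))%:E =
   \int[normal_prob 0 1]_y (G y)%:E)%E.
Proof.
move=> mG G0.
have mGN : measurable_fun setT (fun y : R => G (- y)) by exact: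
  measurableT_comp.
rewrite (normal_prob_integral _ _ (f := EFin \o G)) /=; last 2 first.
- exact/measurable_EFinP.
- by move=> x; rewrite lee_fin.
rewrite (normal_prob_integral _ _ (f := fun y : R => (G (- y))%:E)) /=;
  last 2 first.
- exact/measurable_EFinP.
- by move=> x; rewrite lee_fin.
have pdfN y : normal_pdf 0 1 (- y) = normal_pdf 0 1 y :> R.
  by rewrite !normal_pdfE ?oner_neq0 // /normal_fun !subr0 sqrrN.
transitivity (\int[mu]_y ((fun y => (G y * normal_pdf 0 1 y)%:E) \o -%R) y)%E.
  by apply: eq_integral => y _ /=; rewrite pdfN EFinM.
rewrite -[LHS](@ge0_integral_pushforward _ _ (measurableTypeR R)
  (measurableTypeR R) _
  (-%R : R -> R) _ mu setT (fun y : R => (G y * normal_pdf 0 1 y)%:E)) //.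
- by apply: eq_measure_integral => A mA _; exact: lebesgue_measureN.
- apply/measurable_EFinP; apply: measurable_funM => //;
  exact: measurable_normal_pdf.
- by move=> y _; rewrite lee_fin mulr_ge0 // normal_pdf_ge0.
Qed.

(** The integrand times the standard density is s times the density of the
    centred normal law with standard deviation s. This is the source of all
    numerical bounds on moments. *)
Lemma std_normal_exp_sqr s : 0 < s ->
  (\int[normal_prob 0 1]_y (expR ((1 - (s ^+ 2)^-1) / 2 * y ^+ 2))%:E =
   s%:E :> \bar R)%E.
Proof.
move=> s0; rewrite (normal_prob_integral _ _
  (f := fun y : R => (expR ((1 - (s ^+ 2)^-1) / 2 * y ^+ 2))%:E)) /=;
    last 2 first.
- by apply/measurable_EFinP; apply: measurableT_comp => //;
  apply: measurable_funM.
- by move=> y; rewrite lee_fin expR_ge0.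
transitivity (\int[mu]_y (s%:E * (normal_pdf 0 s y)%:E))%E.
  apply: eq_integral => y _; rewrite -!EFinM; congr EFin.
  rewrite !normal_pdfE ?gt_eqF // !normal_peakE // /normal_fun invr1 mul1r.
  rewrite -[in RHS]mulrA mulVKf ?gt_eqF // mulrCA; congr (_ * _).
  rewrite -expRD; congr expR; rewrite !subr0; field; rewrite gt_eqF //.
rewrite ge0_integralZl ?lee_fin ?ltW //.
- by rewrite integral_normal_pdf mule1.
- by apply/measurable_EFinP; exact: measurable_normal_pdf.
- by move=> y _; rewrite lee_fin normal_pdf_ge0.
Qed.

End normal_law.

Section std_normal_moments.
Context {R : realType}.

Definition std_normal : probability (measurableTypeR R) R := normal_prob 0 1.

Definition std_moment k : R := mean std_normal (fun y : R => y ^+ (k * 2)).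

Lemma std_normal_exp_integrable s : 0 < s ->
  std_normal.-integrable setT
    (EFin \o (fun y : R => expR ((1 - (s ^+ 2)^-1) / 2 * y ^+ 2))).
Proof.
move=> s0; apply/integrableP; split.
  by apply/measurable_EFinP; apply: measurableT_comp => //;
    apply: measurable_funM.
apply: le_lt_trans (ltry s); rewrite -(std_normal_exp_sqr s0) le_eqVlt.
by apply/orP; left; apply/eqP/eq_integral => y _ /=;
  rewrite ger0_norm // expR_ge0.
Qed.

Lemma std_normal_mean_exp s : 0 < s ->
  mean std_normal (fun y : R => expR ((1 - (s ^+ 2)^-1) / 2 * y ^+ 2)) = s.
Proof. by move=> s0; rewrite /mean /Rintegral std_normal_exp_sqr. Qed.

Let exp38E (y : R) : (1 - (2 ^+ 2)^-1) / 2 * y ^+ 2 = 3 / 8 * y ^+ 2.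
Proof. by congr (_ * _); field. Qed.

(* From x^k / k! <= e^x - 1 at x = 3/8 y^2; the exponential e^(3/8 y^2) has mean
   2 under the standard normal law. *)
Let sqr_pow_le (y : R) k :
  y ^+ (k.+1 * 2) <= (8 / 3) ^+ k.+1 * k.+1`!%:R * (expR (3 / 8 * y ^+ 2) - 1).
Proof.
have y20 : 0 <= 3 / 8 * y ^+ 2 by rewrite mulr_ge0 ?sqr_ge0.
have := expR_ge1Dxn k y20; move: (expR _) => E.
rewrite -lerBrDl ler_pdivrMr ?ltr0n ?fact_gt0 // mulnC exprM.
move=> h; rewrite -[leRHS]mulrA [_%:R * (E - 1)]mulrC.
apply: (@le_trans _ _ ((8 / 3) ^+ k.+1 * (3 / 8 * y ^+ 2) ^+ k.+1)).
  by rewrite -exprMn; have -> : 8 / 3 * (3 / 8 * y ^+ 2) = y ^+ 2 by field.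
by rewrite ler_wpM2l // exprn_ge0.
Qed.

Lemma std_normal_has_moments : has_moments std_normal (fun y : R => y).
Proof.
split=> // n.
pose Z (y : R) := 1 + (8 / 3) ^+ n.+1 * n.+1`!%:R * (expR (3 / 8 * y ^+ 2) - 1).
apply: (@integrable_bound _ _ _ std_normal _ Z).
- by apply/measurable_funX; exact: normr_measurable.
- have ie : std_normal.-integrable setT (EFin \o (fun y : R => expR (3 / 8 * y
  ^+ 2))).
    have := std_normal_exp_integrable (@ltr0n R 2).
    by apply: eq_integrable => // y _ /=; rewrite exp38E.
  have i1 : std_normal.-integrable setT (EFin \o (fun=> 1 : R)).
    exact: finite_measure_integrable_cst.
  have := integrableD measurableT i1
    (integrableZl measurableT ((8 / 3) ^+ n.+1 * n.+1`!%:R) (integrableB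
      measurableT ie i1)).
  by apply: eq_integrable => // y _ /=; rewrite /Z EFinD EFinM EFinB.
move=> y; rewrite ger0_norm ?exprn_ge0 // /Z.
apply: (@le_trans _ _ (1 + y ^+ (n.+1 * 2))); last by rewrite lerD2l sqr_pow_le.
have -> : y ^+ (n.+1 * 2) = `|y| ^+ (n.+1 * 2).
  by rewrite mulnC !exprM real_normK ?num_real.
have [y1|/ltW y1] := leP `|y| 1.
  by apply: (@le_trans _ _ 1); rewrite ?exprn_ile1 // lerDl exprn_ge0.
apply: (@le_trans _ _ (`|y| ^+ (n.+1 * 2))); last by rewrite lerDr.
by rewrite ler_weXn2l // muln2 -addnn (leq_trans (leqnSn n)) // leq_addr.
Qed.

(** The subtracted 1 matters: e^(3/8 y^2) - 1 has mean exactly 1, so that no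
    factor is lost against 4^k k! in [gauss_ratio_le]. *)
Lemma std_moment_le k : std_moment k.+1 <= (8 / 3) ^+ k.+1 * k.+1`!%:R.
Proof.
have ie : std_normal.-integrable setT (EFin \o (fun y : R => expR (3 / 8 * y ^+
  2))).
  have := std_normal_exp_integrable (@ltr0n R 2).
  by apply: eq_integrable => // y _ /=; rewrite exp38E.
have i1 : std_normal.-integrable setT (EFin \o (fun=> 1 : R)).
  exact: finite_measure_integrable_cst.
have iB : std_normal.-integrable setT
    (EFin \o (fun y : R => expR (3 / 8 * y ^+ 2) - 1)).
  have := integrableB measurableT ie i1.
  by apply: eq_integrable => // y _ /=; rewrite EFinB.
have E : mean std_normal (fun y : R => expR (3 / 8 * y ^+ 2) - 1) = 1.
  rewrite /mean RintegralB //.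
  have -> : (\int[std_normal]_y expR (3 / 8 * (y : R) ^+ 2))%R = 2.
    rewrite -[RHS](@std_normal_mean_exp 2) //; congr mean.
    by apply/funext => y; rewrite exp38E.
  by rewrite -[X in _ - X]/(mean std_normal (fun=> 1)) mean_cst; ring.
rewrite -[leRHS]mulr1 -[X in _ * X]E /mean -RintegralZl //.
apply: le_Rintegral => //.
- exact/has_moments_integrable/has_momentsX/std_normal_has_moments.
- have := integrableZl measurableT ((8 / 3) ^+ k.+1 * k.+1`!%:R) iB.
  by apply: eq_integrable => // y _ /=; rewrite EFinM.
Qed.

(** The variance of the standard normal law is 1; the lower bound 2/3, enough
    for [gauss_ratio_le], comes from 1 - e^(-x) <= x at x = 9/32 y^2, where
    e^(-x) has mean 4/5. *)
Lemma std_moment1_ge : 2 / 3 <= std_moment 1.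
Proof.
pose e (y : R) : R := expR (- (9 / 32) * y ^+ 2).
have eE (y : R) : expR ((1 - ((4 / 5) ^+ 2)^-1) / 2 * y ^+ 2) = e y.
  by congr (expR (_ * _)); field.
have s0 : 0 < 4 / 5 :> R by [].
have ie : std_normal.-integrable setT (EFin \o e).
  have := std_normal_exp_integrable s0.
  by apply: eq_integrable => // y _ /=; rewrite eE.
have i1 : std_normal.-integrable setT (EFin \o (fun=> 1 : R)).
  exact: finite_measure_integrable_cst.
have iB : std_normal.-integrable setT (EFin \o (fun y : R => 1 - e y)).
  have := integrableB measurableT i1 ie.
  by apply: eq_integrable => // y _ /=; rewrite EFinB.
have E : mean std_normal (fun y : R => 1 - e y) = 1 / 5.
  rewrite /mean RintegralB //.
  have -> : (\int[std_normal]_y e (y : R))%R = 4 / 5.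
    rewrite -[RHS](std_normal_mean_exp s0); congr mean.
    by apply/funext => y; rewrite eE.
  by rewrite -[X in X - _]/(mean std_normal (fun=> 1)) mean_cst; field.
have iy := has_momentsX (1 * 2) std_normal_has_moments.
have : mean std_normal (fun y : R => 1 - e y) <=
   mean std_normal (fun y : R => 9 / 32 * y ^+ (1 * 2)).
  apply: le_Rintegral => //.
    exact/has_moments_integrable/has_momentsZ/iy.
  move=> y _; rewrite lerBlDl -lerBlDr.
  by have := expR_ge1Dx (- (9 / 32) * y ^+ 2); rewrite -/(e y) mul1n; lra.
by rewrite E meanZ // -/(std_moment 1); lra.
Qed.

Lemma std_moment0 : std_moment 0 = 1.
Proof. by rewrite /std_moment -[RHS](mean_cst std_normal). Qed.

Lemma std_moment_ge0 k : 0 <= std_moment k.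
Proof.
by apply: Rintegral_ge0 => y _; rewrite mulnC exprM exprn_ge0 // sqr_ge0.
Qed.

(** The factor by which the moment of order 2k of a centred normal law exceeds
    the k-th power of its variance, equal to (2k)! / (2^k k!). Normalizing by
    the second moment avoids computing it. *)
Definition gauss_ratio k : R := std_moment k / std_moment 1 ^+ k.

Lemma gauss_ratio_ge0 k : 0 <= gauss_ratio k.
Proof. by rewrite divr_ge0 ?exprn_ge0 ?std_moment_ge0. Qed.

Lemma gauss_ratio_le k : gauss_ratio k <= 4 ^+ k * k`!%:R.
Proof.
rewrite /gauss_ratio; case: k => [|k].
  by rewrite std_moment0 !expr0 divr1 mul1r.
have m1 := std_moment1_ge.
have m0 : 0 < std_moment 1 by apply: lt_le_trans m1.
rewrite ler_pdivrMr ?exprn_gt0 //; apply: (le_trans (std_moment_le k)).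
rewrite mulrAC ler_wpM2r // -exprMn lerXn2r ?nnegrE ?mulr_ge0 ?(ltW m0) //.
lra.
Qed.

(** By symmetry; |y| + y is used in place of y in order to integrate a
    nonnegative function. *)
Lemma mean_std_normal : mean std_normal (fun y : R => y) = 0.
Proof.
have hy := std_normal_has_moments.
have habs : has_moments std_normal (fun y : R => `|y|).
  case: hy => mY iY; split; first exact: measurableT_comp.
  move=> n; have := iY n; apply: eq_integrable => // y _ /=.
  by rewrite normr_id.
pose G (y : R) := `|y| + y.
have G0 y : 0 <= G y by rewrite /G; have := ler_norm (- y); rewrite normrN; lra.
have mG : measurable_fun setT G by apply: measurable_funD => //;
  exact: measurableT_comp.
have : mean std_normal (fun y : R => G (- y)) = mean std_normal G.
  by rewrite /mean /Rintegral; congr fine; exact: std_normal_opp.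
rewrite [RHS](meanD habs hy).
have -> : (fun y : R => G (- y)) = (fun y : R => `|y| + -1 * y).
  by apply/funext => y; rewrite /G normrN mulN1r.
rewrite meanD ?meanZ //; last exact: has_momentsZ.
lra.
Qed.

End std_normal_moments.

Section gaussian_moments.
Context {disp : measure_display} {Omega : measurableType disp} {R : realType}.
Variable P : probability Omega R.
Implicit Types X : Omega -> R.

(** A Gaussian variable has the law of m + s Z with Z standard normal,
    degenerate laws being the case s = 0. *)
Lemma gaussian_law X : measurable_fun setT X -> gaussian P X ->
  exists m s : R, forall G : R -> R, continuous G -> (forall x, 0 <= G x) ->
  (\int[P]_w (G (X w))%:E = \int[std_normal]_y (G (m + s * y))%:E)%E.
Proof.
move=> mX [m [sigma law]]; exists m, `|sigma| => G cG G0.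
have mG : measurable_fun setT (EFin \o G).
  by apply/measurable_EFinP; exact: continuous_measurable_fun.
pose X' : Omega -> measurableTypeR R := X.
have -> : (\int[P]_w (G (X w))%:E = \int[pushforward P X']_x (G x)%:E)%E.
  rewrite (@ge0_integral_pushforward _ _ Omega (measurableTypeR R) R X' mX P
    setT (EFin \o G)) //.
  by move=> x _; rewrite /= lee_fin.
have [s0|s0] := eqVneq sigma 0.
  rewrite s0 normr0.
  transitivity (\int[@dirac _ (measurableTypeR R) m R]_x (G x)%:E)%E.
    apply: eq_measure_integral => A mA _; transitivity (P (X @^-1` A)) => //.
    by rewrite law // s0 eqxx.
  rewrite integral_dirac // diracT mul1e.
  under [RHS]eq_integral do rewrite mul0r addr0.
  by rewrite integral_cst // -[X in (_ * X)%E]/(std_normal setT)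
    probability_setT mule1.
transitivity (\int[normal_prob m `|sigma|]_x (G x)%:E)%E.
  apply: eq_measure_integral => A mA _; transitivity (P (X @^-1` A)) => //.
  rewrite law // (negbTE s0) /= /normal_prob.
  apply: eq_integral => x _; congr EFin.
  rewrite !normal_pdfE ?normr_eq0 //.
  by rewrite /normal_peak /normal_fun real_normK ?num_real.
by apply: normal_prob_affine => //; rewrite normr_gt0.
Qed.

(** All moments are read off from m + s Z, and m is the mean. *)
Lemma gaussian_moments X : measurable_fun setT X -> gaussian P X ->
  has_moments P X /\ (mean P X = 0 -> forall k,
   mean P (fun w => X w ^+ (k * 2)) =
   gauss_ratio k * mean P (fun w => X w ^+ 2) ^+ k).
Proof.
move=> mX gX; have [m [s law]] := gaussian_law mX gX.
pose Y : measurableTypeR R -> R := fun y : R => m + s * y.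
have hY : has_moments std_normal Y.
  apply: has_momentsD; first exact: has_moments_cst.
  by apply: has_momentsZ; exact: std_normal_has_moments.
have cX n : continuous (fun x : R => `|x| ^+ n).
  move=> x; apply: (@continuous_comp _ _ _ (fun x : R => `|x|) (fun x : R => x
    ^+ n)).
    exact: (@norm_continuous R R^o).
  exact: exprn_continuous.
have hX : has_moments P X.
  split=> // n; apply/integrableP; split.
    by apply/measurable_EFinP/measurable_funX; exact: measurableT_comp.
  have /integrableP[_] := hY.2 n; apply: le_lt_trans.
  rewrite le_eqVlt; apply/orP; left; apply/eqP.
  transitivity (\int[P]_w (`|X w| ^+ n)%:E)%E.
    by apply: eq_integral => w _ /=; rewrite ger0_norm ?exprn_ge0.
  rewrite (law (fun x => `|x| ^+ n)) //.
  apply: eq_integral => y _ /=. by rewrite [in RHS]ger0_norm ?exprn_ge0.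
split=> // mean0.
have evenE k : mean P (fun w => X w ^+ (k * 2)) =
    mean std_normal (fun y : R => (m + s * y) ^+ (k * 2)).
  rewrite /mean /Rintegral; congr fine; apply: (law (fun x => x ^+ (k * 2))).
    exact: exprn_continuous.
  by move=> x; rewrite mulnC exprM exprn_ge0 // sqr_ge0.
have hA : has_moments P (fun w => `|X w|).
  split; first exact: measurableT_comp.
  by move=> n; have := hX.2 n; apply: eq_integrable => // w _ /=;
    rewrite normr_id.
have hB : has_moments std_normal (fun y => `|Y y|).
  split; first by apply: measurableT_comp => //; exact: hY.1.
  by move=> n; have := hY.2 n; apply: eq_integrable => // w _ /=;
    rewrite normr_id.
have m0 : m = 0.
  have := mean0.
  have e1 : mean P (fun w => `|X w| + X w) = mean std_normal (fun y => `|Y y| +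
    Y y).
    rewrite /mean /Rintegral; congr fine; apply: (law (fun x => `|x| + x)).
      by move=> x; apply: continuousD; [exact: norm_continuous|exact: cvg_id].
    by move=> x; have := ler_norm (- x); rewrite normrN; lra.
  have e2 : mean P (fun w => `|X w|) = mean std_normal (fun y => `|Y y|).
    rewrite /mean /Rintegral; congr fine; apply: (law (fun x => `|x|)).
      exact: norm_continuous.
    by move=> x.
  move: e1; rewrite (meanD hA hX) (meanD hB hY) e2 => /addrI -> .
  rewrite meanD ?meanZ ?mean_cst ?mean_std_normal ?mulr0 ?addr0 //.
  - exact: std_normal_has_moments.
  - exact: has_moments_cst.
  - exact/has_momentsZ/std_normal_has_moments.
move=> k; rewrite evenE (_ : 2 = 1 * 2)%N // evenE m0.
have pE j : mean std_normal (fun y : R => (0 + s * y) ^+ (j * 2)) =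
    s ^+ (j * 2) * std_moment j.
  rewrite -meanZ; last exact/has_momentsX/std_normal_has_moments.
  by congr mean; apply/funext => y; rewrite add0r exprMn.
rewrite !pE /gauss_ratio exprMn -exprM mul1n [(2 * k)%N]mulnC.
have m1 : std_moment 1 != 0 :> R.
  by rewrite gt_eqF // (lt_le_trans _ std_moment1_ge).
by field; rewrite expf_neq0.
Qed.

End gaussian_moments.

(** * Coefficientwise domination of polynomials *)

Section word_polynomials.
Context {Omega : Type} {R : comPzRingType} {A : Type}.
Variables (X X' : A -> Omega -> R).
Implicit Types (Y Z : Omega -> R) (L : seq (seq A)).

(** Polynomials with coefficients in nat are lists of words, each monomial being
    repeated according to its coefficient: nonnegativity of the coefficients is
    built in, and evaluation at two families X and X' keeps track of the
    correspondence of their monomials. *)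
Definition word_monomial (x : A -> Omega -> R) (u : seq A) w : R :=
  \prod_(a <- u) x a w.

Definition word_polynomial (x : A -> Omega -> R) L w : R :=
  \sum_(u <- L) word_monomial x u w.

Definition homogeneous n L := all (fun u => size u == n) L.

(** Y is a polynomial in X, and Y' is the same polynomial in X' increased by
    another one, all being homogeneous of degree n. With means of monomials
    monotone from X to X' and nonnegative in X', this implies
    mean Y <= mean Y'. *)
Definition dominated n Y Y' := exists L1 L2,
  [/\ homogeneous n L1, homogeneous n L2, Y = word_polynomial X L1
    & Y' = (fun w => word_polynomial X' L1 w + word_polynomial X' L2 w)].

Lemma word_polynomial_nil x w : word_polynomial x [::] w = 0.
Proof. by rewrite /word_polynomial big_nil. Qed.

Lemma word_polynomial_cat x L L' w :
  word_polynomial x (L ++ L') w = word_polynomial x L w + word_polynomial x L'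
    w.
Proof. by rewrite /word_polynomial big_cat. Qed.

Lemma word_polynomialM x L L' w :
  word_polynomial x [seq u ++ v | u <- L, v <- L'] w =
  word_polynomial x L w * word_polynomial x L' w.
Proof.
rewrite /word_polynomial big_allpairs_dep mulr_suml; apply: eq_bigr => u _.
by rewrite mulr_sumr; apply: eq_bigr => v _; rewrite /word_monomial big_cat.
Qed.

Lemma homogeneousM n m L L' : homogeneous n L -> homogeneous m L' ->
  homogeneous (n + m)%N [seq u ++ v | u <- L, v <- L'].
Proof.
move=> hL hL'; elim: L hL => //= u L IH /andP[/eqP su /IH hL].
rewrite /homogeneous all_cat; apply/andP; split=> //.
elim: L' hL' {IH hL} => //= v L' IH /andP[/eqP sv /IH ->].
by rewrite size_cat su sv eqxx.
Qed.

Lemma homogeneous_cat n L L' :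
  homogeneous n (L ++ L') = homogeneous n L && homogeneous n L'.
Proof. exact: all_cat. Qed.

Lemma dominated0 n : dominated n (fun=> 0) (fun=> 0).
Proof.
exists [::], [::]; split=> //; apply/funext => w.
  by rewrite word_polynomial_nil.
by rewrite word_polynomial_nil addr0.
Qed.

Lemma dominated1 : dominated 0 (fun=> 1) (fun=> 1).
Proof.
by exists [:: [::]], [::]; split=> //; apply/funext => w;
  rewrite /word_polynomial /word_monomial big_seq1 !big_nil ?addr0.
Qed.

Lemma dominated_gen a : dominated 1 (X a) (X' a).
Proof.
by exists [:: [:: a]], [::]; split=> //; apply/funext => w;
  rewrite /word_polynomial /word_monomial !big_seq1 ?big_nil ?addr0.
Qed.

Lemma dominatedD n Y Y' Z Z' : dominated n Y Y' -> dominated n Z Z' ->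
  dominated n (fun w => Y w + Z w) (fun w => Y' w + Z' w).
Proof.
move=> [L1 [L2 [h1 h2 -> ->]]] [M1 [M2 [g1 g2 -> ->]]].
exists (L1 ++ M1), (L2 ++ M2); rewrite !homogeneous_cat h1 h2 g1 g2.
by split=> //; apply/funext => w; rewrite !word_polynomial_cat // addrACA.
Qed.

Lemma dominatedM n m Y Y' Z Z' : dominated n Y Y' -> dominated m Z Z' ->
  dominated (n + m)%N (fun w => Y w * Z w) (fun w => Y' w * Z' w).
Proof.
move=> [L1 [L2 [h1 h2 -> ->]]] [M1 [M2 [g1 g2 -> ->]]].
pose prods L M : seq (seq A) := [seq u ++ v | u <- L, v <- M].
exists (prods L1 M1), (prods L1 M2 ++ (prods L2 M1 ++ prods L2 M2)).
rewrite !homogeneous_cat !homogeneousM //; split=> //; apply/funext => w.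
  by rewrite word_polynomialM.
by rewrite !word_polynomial_cat !word_polynomialM; ring.
Qed.

Lemma dominatedX n m Y Y' : dominated n Y Y' ->
  dominated (m * n)%N (fun w => Y w ^+ m) (fun w => Y' w ^+ m).
Proof.
move=> h; elim: m => [|m IH]; first exact: dominated1.
have := dominatedM h IH; rewrite mulSn; congr dominated; apply/funext => w;
  by rewrite exprS.
Qed.

Lemma dominatedMn n m Y Y' : dominated n Y Y' ->
  dominated n (fun w => m%:R * Y w) (fun w => m%:R * Y' w).
Proof.
move=> h; elim: m => [|m IH].
  have := dominated0 n; congr dominated; apply/funext => w;
  by rewrite mul0r.
have := dominatedD h IH; congr dominated; apply/funext => w;
  by rewrite -nat1r mulrDl mul1r.
Qed.

Lemma dominated_ge0 n Y Y' : dominated n Y Y' -> dominated n (fun=> 0) Y'.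
Proof.
move=> [L1 [L2 [h1 h2 _ ->]]]; exists [::], (L1 ++ L2).
rewrite homogeneous_cat h1; split=> //; apply/funext => w.
  by rewrite word_polynomial_nil.
by rewrite word_polynomial_cat word_polynomial_nil add0r.
Qed.

(** The remainder R_p of (a + b)^(p+1) after its terms of degree at most one in
    b has nonnegative coefficients because
    R_(p+1) = (a + b) R_p + (p + 1) a^p b^2. *)
Lemma bernoulli_remainder n a b Y Z : dominated n Y a -> dominated n Z b ->
  forall p, dominated (p.+1 * n)%N (fun=> 0)
   (fun w => (a w + b w) ^+ p.+1 - a w ^+ p.+1 - p.+1%:R * (a w ^+ p * b w)).
Proof.
move=> /dominated_ge0 ha /dominated_ge0 hb; elim=> [|p IH].
  have := dominated0 (1 * n)%N; congr dominated; apply/funext => w.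
  by rewrite !expr1 expr0; ring.
have hab := dominatedD ha hb.
have h2 := dominatedMn p.+1 (dominatedM (dominatedX p ha) (dominatedM hb hb)).
have h1 := dominatedM hab IH.
have e : ((p * n + (n + n)) = p.+2 * n)%N by rewrite !mulSn addnC addnA.
rewrite e in h2; rewrite -mulSn in h1.
have := dominated_ge0 (dominatedD h1 h2); congr dominated; apply/funext => w.
by rewrite !exprS -[p.+2%:R]nat1r -[p.+1%:R]nat1r; ring.
Qed.

End word_polynomials.

Section discrete_signature_domination.
Context {Omega : Type} {R : realType} {d : nat}.
Variables (g : 'I_d -> nat -> Omega -> R) (i0 : 'I_d).

Definition increment (a : 'I_d * nat) w : R := g a.1 a.2.+1 w - g a.1 a.2 w.

Definition diag_increment (a : 'I_d * nat) : Omega -> R := increment (i0, a.2).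

(** Induction on the length p and on l. Passing from l to l+1 adds
    (p + 1) (p! S_I(l)) X_l to (p + 1)! S_(I i), which is dominated by
    (p + 1) x^p y, where x is the total increment up to l and y the next one;
    and x^(p+1) + (p + 1) x^p y is dominated by (x + y)^(p+1). *)
Lemma dominated_discrete_signature (I : seq 'I_d) l :
  dominated increment diag_increment (size I)
   (fun w => (size I)`!%:R * discrete_signature (fun i l => g i l w) I l)
   (fun w => (g i0 l w - g i0 0%N w) ^+ size I).
Proof.
elim/last_ind: I l => [|I i IH] l.
  have := dominated1 increment diag_increment; congr dominated.
  by apply/funext => w; rewrite /discrete_signature /= mulr1.
rewrite size_rcons; elim: l => [|l IHl].
  have := dominated0 increment diag_increment (size I).+1.
  congr dominated; apply/funext => w; first by rewrite discrete_signature0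
    size_rcons mulr0.
  by rewrite subrr expr0n.
have hx : exists Y, dominated increment diag_increment 1 Y
    (fun w => g i0 l w - g i0 0%N w).
  exists (fun=> 0); elim: l {IHl} => [|l h].
    have := dominated0 increment diag_increment 1; congr dominated.
    by apply/funext => w; rewrite subrr.
  have := dominatedD h (dominated_ge0 (dominated_gen increment diag_increment
    (i0, l))).
  congr dominated; apply/funext => w; first by rewrite addr0.
  by rewrite /diag_increment /increment /=; ring.
have [Y hY] := hx.
have hg := dominated_gen increment diag_increment (i, l).
have rem := bernoulli_remainder hY hg (size I).
have step := dominatedMn (size I).+1 (dominatedM (IH l) hg).
rewrite muln1 in rem; rewrite addn1 in step.
have := dominatedD (dominatedD IHl step) rem; congr dominated;
  apply/funext => w.
  rewrite !discrete_signature_rcons big_nat_recr //= /increment /= addr0 factS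
    natrM.
  by ring.
set x := g i0 l w - g i0 0%N w.
have -> : g i0 l.+1 w - g i0 0%N w = x + diag_increment (i, l) w.
  by rewrite /x /diag_increment /increment /=; ring.
by move: (diag_increment _ _) => y; ring.
Qed.

End discrete_signature_domination.

(** * Covariances of fractional Brownian motion *)

Section independence.
Context {disp : measure_display} {Omega : measurableType disp} {R : realType}.
Variable P : probability Omega R.

Lemma integral_independent (X Y : {RV P >-> R}) (f g : R -> R) :
  (forall A A' : set R, measurable A -> measurable A' ->
     P (X @^-1` A `&` Y @^-1` A') = (P (X @^-1` A) * P (Y @^-1` A'))%E) ->
  measurable_fun setT f -> measurable_fun setT g ->
  (forall x, 0 <= f x) -> (forall x, 0 <= g x) ->
  (\int[P]_w (f (X w) * g (Y w))%:E =
   \int[P]_w (f (X w))%:E * \int[P]_w (g (Y w))%:E)%E.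
Proof.
move=> indep mf mg f0 g0.
pose XY w := (X w, Y w).
have mXY : measurable_fun setT XY.
  by apply: measurable_fun_pair; exact: measurable_funPT.
pose F (z : R * R) := (f z.1 * g z.2)%:E.
have mF : measurable_fun setT F.
  apply/measurable_EFinP; apply: measurable_funM.
    exact: measurableT_comp mf measurable_fst.
  exact: measurableT_comp mg measurable_snd.
have F0 z : (0 <= F z)%E by rewrite lee_fin mulr_ge0.
transitivity (\int[pushforward P XY]_z F z)%E.
  by rewrite (ge0_integral_pushforward mXY) //.
transitivity (\int[distribution P X \x distribution P Y]_z F z)%E.
  apply: eq_measure_integral => A mA _; apply/esym.
  pose m' := measure_function_pushforward__canonical__measure_function_Measure
    P mXY.
  by apply: (product_measure_unique (m' := m'))
    => // B C mB mC; rewrite /m' /= -indep.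
rewrite fubini_tonelli1 //.
transitivity (\int[distribution P X]_x ((f x)%:E * \int[distribution P Y]_y (g
  y)%:E))%E.
  apply: eq_integral => x _; rewrite /fubini_F -ge0_integralZl //.
  - exact/measurable_EFinP.
  - by move=> y _; rewrite lee_fin.
  - by rewrite lee_fin.
rewrite ge0_integralZr //.
- rewrite ge0_integral_distribution //; last exact/measurable_EFinP.
  by rewrite ge0_integral_distribution //; exact/measurable_EFinP.
- exact/measurable_EFinP.
- by move=> x _; rewrite lee_fin.
- by apply: integral_ge0 => y _; rewrite lee_fin.
Qed.

(** Tonelli's theorem for the joint law, applied to the four products of
    |x| + x and |x| with |y| + y and |y|. *)
Lemma mean_independent (X Y : {RV P >-> R}) :
  (forall A A' : set R, measurable A -> measurable A' ->
     P (X @^-1` A `&` Y @^-1` A') = (P (X @^-1` A) * P (Y @^-1` A'))%E) ->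
  has_moments P X -> has_moments P Y ->
  mean P (fun w => X w * Y w) = mean P X * mean P Y.
Proof.
move=> indep hX hY.
pose pos (x : R) : R := `|x| + x; pose abs (x : R) : R := `|x|.
have mabs : measurable_fun setT abs by exact: normr_measurable.
have mpos : measurable_fun setT pos by exact: measurable_funD.
have pos0 x : 0 <= pos x by rewrite /pos; have := ler_norm (- x);
  rewrite normrN; lra.
have abs0 x : 0 <= abs x by rewrite /abs.
have habs Z : has_moments P Z -> has_moments P (fun w => abs (Z w)).
  move=> [mZ iZ]; split; first exact: measurableT_comp.
  by move=> n; have := iZ n; apply: eq_integrable => // w _ /=;
    rewrite normr_id.
have hpos Z : has_moments P Z -> has_moments P (fun w => pos (Z w)).
  by move=> hZ; apply: has_momentsD => //; exact: habs.
have fin Z : has_moments P Z -> (\int[P]_w (Z w)%:E = (mean P Z)%:E)%E.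
  move=> /has_moments_integrable iZ; rewrite /mean /Rintegral fineK //.
  exact: integrable_fin_num.
have prod (f g : R -> R) : measurable_fun setT f -> measurable_fun setT g ->
   (forall x, 0 <= f x) -> (forall x, 0 <= g x) ->
   has_moments P (f \o X) -> has_moments P (g \o Y) ->
   mean P (fun w => f (X w) * g (Y w)) = mean P (f \o X) * mean P (g \o Y).
  move=> mf mg f0 g0 hf hg; apply: EFin_inj; rewrite -fin;
    last exact: has_momentsM.
  by rewrite integral_independent // EFinM -!fin.
have E (Z : Omega -> R) : has_moments P Z -> mean P Z = mean P (pos \o Z) -
  mean P (abs \o Z).
  move=> hZ; rewrite (_ : pos \o Z = fun w => abs (Z w) + Z w) //.
  by rewrite meanD //; [ring|exact: habs].
rewrite (E _ hX) (E _ hY).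
have hN (Z : Omega -> R) : has_moments P Z -> has_moments P (fun w => -1 * Z w)
  by exact: has_momentsZ.
transitivity (mean P (fun w => (pos (X w) * pos (Y w) + -1 * (pos (X w) * abs
  (Y w)))
   + (abs (X w) * abs (Y w) + -1 * (abs (X w) * pos (Y w))))).
  by congr mean; apply/funext => w; rewrite /pos /abs; ring.
have pX := hpos _ hX; have pY := hpos _ hY.
have aX := habs _ hX; have aY := habs _ hY.
have hpp := has_momentsM pX pY; have hpa := has_momentsM pX aY.
have hap := has_momentsM aX pY; have haa := has_momentsM aX aY.
rewrite (meanD (has_momentsD hpp (hN _ hpa)) (has_momentsD haa (hN _ hap))).
rewrite (meanD hpp (hN _ hpa)) (meanD haa (hN _ hap)) !meanZ //.
by rewrite !prod //; ring.
Qed.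

End independence.

Section fbm.
Context {disp : measure_display} {Omega : measurableType disp} {R : realType}.
Variables (P : probability Omega R) (H : R) (d : nat) (B : 'I_d -> R -> {RV P
  >-> R}).
Hypothesis hB : fractional_brownian_motion H B.

Lemma fbm_value_gaussian i t : 0 <= t -> gaussian P (B i t).
Proof.
move=> t0; have := fbm_gaussian hB (n := 1) (fun=> i) (fun=> 1) (t := fun=> t).
move=> /(_ (fun=> t0)); congr gaussian; apply/funext => w.
by rewrite big_ord1 mul1r.
Qed.

Lemma fbm_has_moments i t : 0 <= t -> has_moments P (B i t).
Proof.
move=> t0; have [] // := gaussian_moments _ (fbm_value_gaussian i t0).
Qed.

Lemma mean_fbm i t : 0 <= t -> mean P (B i t) = 0.
Proof.
move=> t0; rewrite /mean /Rintegral.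
by have := fbm_centered hB i t0; rewrite unlock => ->.
Qed.

Lemma fbm_cov i s t : 0 <= s -> 0 <= t -> mean P (fun w => B i t w * B i s w) =
  2^-1 * (t `^ (2 * H) + s `^ (2 * H) - `|t - s| `^ (2 * H)).
Proof.
move=> s0 t0; rewrite /mean /Rintegral.
by have := fbm_covariance hB i s0 t0; rewrite unlock => ->.
Qed.

Lemma fbm_cross i j s t : i != j -> 0 <= s -> 0 <= t ->
  mean P (fun w => B i t w * B j s w) = 0.
Proof.
move=> ij s0 t0; rewrite mean_independent ?mean_fbm ?mul0r //.
- move=> A A' mA mA'.
  pose E l := if l == i then B i t @^-1` A else if l == j then B j s @^-1` A'
    else setT.
  have hE l : process_sigma_algebra (B l) (E l).
    apply: sub_sigma_algebra; rewrite /E; case: eqP => [->|_].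
      by exists t => //; exists A => //; rewrite setTI.
    case: eqP => [->|_]; first by exists s => //; exists A' => //;
      rewrite setTI.
    by exists 0 => /=; rewrite ?lexx //; exists setT => //;
      rewrite setTI preimage_setT.
  have := fbm_independent hB hE.
  have -> : \bigcap_l E l = B i t @^-1` A `&` B j s @^-1` A'.
    apply/seteqP; split=> w.
      move=> h; split; first by have := h i I; rewrite /E eqxx.
      by have := h j I; rewrite /E eq_sym (negbTE ij) eqxx.
    move=> [h1 h2] l _; rewrite /E; case: eqP => // _; case: eqP => //.
  move=> ->; rewrite (bigD1 i) //= (bigD1 j) 1?eq_sym //= big1 ?mule1.
    by rewrite /E eqxx eq_sym (negbTE ij) eqxx.
  by move=> l /andP[li lj]; rewrite /E (negbTE li) (negbTE lj) probability_setT.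
- exact: fbm_has_moments.
- exact: fbm_has_moments.
Qed.

End fbm.

(** The second difference of |r|^theta is nonnegative. For theta = 2H it is
    twice the covariance of two increments over cells of length h at distance
    r. *)
Lemma powR_norm_midconvex {R : realType} (theta r h : R) : 1 <= theta ->
  2 * `|r| `^ theta <= `|r + h| `^ theta + `|r - h| `^ theta.
Proof.
move=> th1.
have half0 : 0 <= (2^-1 : R) by lra.
have half1 : (2^-1 : R) <= 1 by lra.
have := @convex_powR R theta th1 (Itv01 half0 half1) `|r + h| `|r - h|.
rewrite !inE /= !in_itv /= !andbT => /(_ (normr_ge0 _) (normr_ge0 _)).
rewrite convRE [X in X `^ _ <= _]convRE /= /unstable.onem => cvx.
have mid : `|r| <= 2^-1 * `|r + h| + (1 - 2^-1) * `|r - h|.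
  have := ler_normD (r + h) (r - h).
  have -> : r + h + (r - h) = 2 * r by ring.
  rewrite normrM ger0_norm //; lra.
have := ler_powR_r (le_trans ler01 th1) (normr_ge0 r) mid.
by move=> /le_trans /(_ cvx); lra.
Qed.

Section fbm_increments.
Context {disp : measure_display} {Omega : measurableType disp} {R : realType}.
Variables (P : probability Omega R) (H : R) (d : nat) (B : 'I_d -> R -> {RV P
  >-> R}).
Hypotheses (hB : fractional_brownian_motion H B) (hH : 2^-1 < H).

Lemma fbm_incr_has_moments i u v : 0 <= u -> 0 <= v ->
  has_moments P (fun w => B i u w - B i v w).
Proof.
move=> u0 v0; under eq_fun do rewrite -mulN1r; apply: has_momentsD.
  exact: fbm_has_moments hB _ _ u0.
by apply: has_momentsZ; exact: fbm_has_moments hB _ _ v0.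
Qed.

Lemma mean_fbm_incr i u v : 0 <= u -> 0 <= v ->
  mean P (fun w => B i u w - B i v w) = 0.
Proof.
move=> u0 v0; under eq_fun do rewrite -mulN1r.
have hu := fbm_has_moments hB i u0; have hv := fbm_has_moments hB i v0.
rewrite (meanD hu (has_momentsZ (-1) hv)) meanZ //.
by rewrite !(mean_fbm hB) // mulr0 addr0.
Qed.

Lemma mean_fbm_incrM i j u v p q : 0 <= u -> 0 <= v -> 0 <= p -> 0 <= q ->
  mean P (fun w => (B i u w - B i v w) * (B j p w - B j q w)) =
  (i == j)%:R * (2^-1 * (`|u - q| `^ (2 * H) + `|v - p| `^ (2 * H)
     - `|u - p| `^ (2 * H) - `|v - q| `^ (2 * H))).
Proof.
move=> u0 v0 p0 q0.
have hM x y : 0 <= x -> 0 <= y -> has_moments P (fun w => B i x w * B j y w).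
  by move=> x0 y0; apply: has_momentsM; exact: (fbm_has_moments hB).
have hN x y : 0 <= x -> 0 <= y -> has_moments P (fun w => -1 * (B i x w * B j y
  w)).
  by move=> x0 y0; apply: has_momentsZ; exact: hM.
transitivity (mean P (fun w => (B i u w * B j p w + -1 * (B i u w * B j q w)) +
  (B i v w * B j q w + -1 * (B i v w * B j p w)))).
  by congr mean; apply/funext => w; ring.
rewrite (meanD (has_momentsD (hM _ _ u0 p0) (hN _ _ u0 q0))
  (has_momentsD (hM _ _ v0 q0) (hN _ _ v0 p0))).
rewrite (meanD (hM _ _ u0 p0) (hN _ _ u0 q0)) (meanD (hM _ _ v0 q0) (hN _ _ v0
  p0)).
rewrite !meanZ; try exact: hM.
have [eij|nij] := eqVneq i j; last first.
  by rewrite !(fbm_cross hB nij) // mulr0 !addr0 mul0r.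
by rewrite eij !(fbm_cov hB) // mul1r; ring.
Qed.

Lemma fbm_increments_gaussian n (i : 'I_n -> 'I_d) (u v c : 'I_n -> R) :
  (forall a, 0 <= u a) -> (forall a, 0 <= v a) ->
  gaussian P (fun w => \sum_(a < n) c a * (B (i a) (u a) w - B (i a) (v a) w)).
Proof.
move=> u0 v0.
pose i2 (a : 'I_(n + n)) := match fintype.split a with inl b => i b | inr b =>
  i b end.
pose t2 (a : 'I_(n + n)) := match fintype.split a with inl b => u b | inr b =>
  v b end.
pose c2 (a : 'I_(n + n)) := match fintype.split a with inl b => c b | inr b =>
  - c b end.
have := fbm_gaussian hB i2 c2 (t := t2).
have t20 j : 0 <= t2 j by rewrite /t2; case: fintype.split.
move=> /(_ t20); congr gaussian; apply/funext => w.
rewrite big_split_ord /= -big_split /=; apply: eq_bigr => a _.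
rewrite /i2 /t2 /c2.
rewrite (unsplitK (inl a)) (unsplitK (inr a)); ring.
Qed.

Lemma fbm_increments_moments n (i : 'I_n -> 'I_d) (u v c : 'I_n -> R) k :
  (forall a, 0 <= u a) -> (forall a, 0 <= v a) ->
  mean P (fun w => (\sum_(a < n) c a * (B (i a) (u a) w - B (i a) (v a) w)) ^+
    (k * 2)) =
  gauss_ratio k *
   mean P (fun w => (\sum_(a < n) c a * (B (i a) (u a) w - B (i a) (v a) w)) ^+
     2) ^+ k.
Proof.
move=> u0 v0.
have hinc a : has_moments P (fun w => c a * (B (i a) (u a) w - B (i a) (v a)
  w)).
  by apply: has_momentsZ; exact: fbm_incr_has_moments.
have hS := has_moments_sum (index_enum 'I_n) xpredT hinc.
have [_ ] := gaussian_moments hS.1 (fbm_increments_gaussian i c u0 v0).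
apply; rewrite mean_sum // big1 // => a _.
by rewrite meanZ ?mean_fbm_incr ?mulr0 //; exact: fbm_incr_has_moments.
Qed.

(** * Second moments of grid signatures *)

Section on_grid.
Variables (s t : R) (N : nat) (i0 : 'I_d).
Hypotheses (s0 : 0 <= s) (st : s <= t).

Let x := grid s t N.
Let g i l w : R := B i (x l) w.

Let x0 l : 0 <= x l.
Proof. by rewrite addr_ge0 // mulr_ge0 // divr_ge0 // subr_ge0. Qed.

Let xS l : x l.+1 = x l + (t - s) / N.+1%:R.
Proof. by rewrite /x /grid -natr1; ring. Qed.

(* On a uniform grid all cells have the same length, and the covariance of two
   increments is a second difference of |r|^(2H). *)
Let word_mean_le k (u : seq ('I_d * nat)) : size u = (k * 2)%N ->
  0 <= mean P (word_monomial (increment g) u) <=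
    mean P (word_monomial (diag_increment g i0) u).
Proof.
move=> /eqP su; pose U := Tuple su.
have E (X : 'I_d * nat -> Omega -> R) :
    word_monomial X u = (fun w => \prod_a X (tnth U a) w).
  by apply/funext => w; rewrite /word_monomial (big_tuple _ _ U).
rewrite !E; apply: (isserlis_le (gauss_ratio_ge0 k)).
- by move=> a; exact: fbm_incr_has_moments.
- by move=> a; exact: fbm_incr_has_moments.
- by move=> c; apply: fbm_increments_moments => a; exact: x0.
- by move=> c; apply: (fbm_increments_moments (fun=> i0)) => a; exact: x0.
move=> a b; rewrite /diag_increment /increment /=.
rewrite !mean_fbm_incrM // eqxx mul1r.
have C0 : 0 <= 2^-1 * (`|x (tnth U a).2.+1 - x (tnth U b).2| `^ (2 * H)
    + `|x (tnth U a).2 - x (tnth U b).2.+1| `^ (2 * H)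
    - `|x (tnth U a).2.+1 - x (tnth U b).2.+1| `^ (2 * H)
    - `|x (tnth U a).2 - x (tnth U b).2| `^ (2 * H)).
  rewrite !xS; move: (x (tnth U a).2) (x (tnth U b).2) => y z;
    set h := (t - s) / _.
  have th1 : 1 <= 2 * H by move: hH => ?; lra.
  have := powR_norm_midconvex (y - z) h th1.
  have -> : y + h - z = y - z + h by ring.
  have -> : y - (z + h) = y - z - h by ring.
  have -> : y + h - (z + h) = y - z by ring.
  by move=> ?; lra.
case: eqP => _; first by rewrite mul1r C0 lexx.
by rewrite mul0r lexx.
Qed.

Let hmon u : has_moments P (word_monomial (increment g) u).
Proof. by apply: has_moments_prod => a; exact: fbm_incr_has_moments. Qed.

Let hmon' u : has_moments P (word_monomial (diag_increment g i0) u).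
Proof. by apply: has_moments_prod => a; exact: fbm_incr_has_moments. Qed.

Lemma dominated_mean_le k Y Y' :
  dominated (increment g) (diag_increment g i0) (k * 2)%N Y Y' ->
  mean P Y <= mean P Y'.
Proof.
move=> [L1 [L2 [h1 h2 -> ->]]].
have hp X : (forall u, has_moments P (word_monomial X u)) -> forall L : seq
  (seq ('I_d * nat)),
   has_moments P (word_polynomial X L) by move=> hX L; exact: has_moments_sum.
rewrite meanD; [|exact: hp|exact: hp].
have E X : (forall u, has_moments P (word_monomial X u)) -> forall L : seq (seq
  ('I_d * nat)),
    mean P (word_polynomial X L) = \sum_(u <- L) mean P (word_monomial X u).
  by move=> hX L; exact: mean_sum.
rewrite !E //.
apply: (@le_trans _ _ (\sum_(u <- L1) mean P (word_monomial (diag_increment g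
  i0) u))).
  rewrite big_seq [leRHS]big_seq; apply: ler_sum => u /(allP h1) /eqP su.
  by have /andP[] := word_mean_le su.
rewrite lerDl big_seq sumr_ge0 // => u /(allP h2) /eqP su.
by have /andP[/le_trans] := word_mean_le su; apply.
Qed.

(** Squaring [dominated_discrete_signature] at the last node of the grid, where
    the total increment is B_t - B_s for the component i0. *)
Lemma mean_discrete_signature_sqr (I : seq 'I_d) :
  mean P (fun w => grid_signature (fun i u => B i u w) I s t N N.+1 ^+ 2) <=
  (4 * (t - s) `^ (2 * H)) ^+ size I / (size I)`!%:R.
Proof.
pose p := size I.
have := dominatedX 2 (dominated_discrete_signature g i0 I N.+1).
rewrite mulnC => /dominated_mean_le.
have xN : x N.+1 = t by rewrite /x /grid mulrCA divff ?pnatr_eq0 // mulr1; ring.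
have x00 : x 0%N = s by rewrite /x /grid mul0r addr0.
have t0 : 0 <= t := le_trans s0 st.
have hsig J l : has_moments P (fun w => discrete_signature (fun i l => g i l w)
  J l).
  elim/last_ind: J l => [|J i IH] l; first exact: has_moments_cst.
  under eq_fun do rewrite discrete_signature_rcons.
  apply: has_moments_sum => j; apply: has_momentsM => //.
  exact: fbm_incr_has_moments.
have moments : mean P (fun w => (B i0 t w - B i0 s w) ^+ (size I * 2)) =
    gauss_ratio (size I) * (t - s) `^ (2 * H) ^+ size I.
  have e w : B i0 t w - B i0 s w = \sum_(a < 1) 1 * (B i0 t w - B i0 s w).
    by rewrite big_ord1 mul1r.
  transitivity (mean P (fun w => (\sum_(a < 1) 1 * (B i0 t w - B i0 s w)) ^+
    (size I * 2))).
    by congr mean; apply/funext => w; rewrite -e.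
  rewrite (@fbm_increments_moments 1 (fun=> i0) (fun=> t) (fun=> s) (fun=> 1))
    //.
  congr (_ * _ ^+ _).
  transitivity (mean P (fun w => (B i0 t w - B i0 s w) * (B i0 t w - B i0 s
    w))).
    by congr mean; apply/funext => w; rewrite -e expr2.
  rewrite mean_fbm_incrM // eqxx mul1r !subrr normr0.
  rewrite powR0; last by rewrite gt_eqF //; move: hH => ?; lra.
  by rewrite (distrC s t) !subr0 ger0_norm ?subr_ge0 //; field.
have -> : mean P (fun w => ((size I)`!%:R *
    discrete_signature (fun i l => g i l w) I N.+1) ^+ 2) = (size I)`!%:R ^+ 2 *
    mean P (fun w => grid_signature (fun i u => B i u w) I s t N N.+1 ^+ 2).
  rewrite -meanZ; last exact/has_momentsX/hsig.
  by congr mean; apply/funext => w; rewrite exprMn.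
have -> : mean P (fun w => ((g i0 N.+1 w - g i0 0%N w) ^+ size I) ^+ 2) =
    gauss_ratio (size I) * (t - s) `^ (2 * H) ^+ size I.
  by rewrite -moments; congr mean; apply/funext => w; rewrite /g xN x00 exprM.
move=> main.
have {main} : (size I)`!%:R ^+ 2 * mean P (fun w =>
   grid_signature (fun i u => B i u w) I s t N N.+1 ^+ 2) <=
   4 ^+ size I * (size I)`!%:R * (t - s) `^ (2 * H) ^+ size I.
  apply: (le_trans main).
  by rewrite ler_wpM2r ?exprn_ge0 ?powR_ge0 // gauss_ratio_le.
have f0 : 0 < (size I)`!%:R :> R by rewrite ltr0n fact_gt0.
rewrite exprMn ler_pdivlMr // => h.
rewrite -(ler_pM2r f0) -mulrA -expr2 mulrC; apply: (le_trans h).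
by rewrite le_eqVlt; apply/orP; left; apply/eqP; ring.
Qed.

End on_grid.
End fbm_increments.

(** * Passage to the limit *)

Section integral_bounds.
Local Open Scope ereal_scope.
Context {disp : measure_display} {T : measurableType disp} {R : realType}.
Variable mu : {measure set T -> \bar R}.

Import HBNNSimple.

(** The integral of a nonnegative function is a supremum over simple functions
    below it, and a simple function is measurable; so only the upper function
    has to be. *)
Lemma integral_le_ae_dominated (f G : T -> \bar R) : measurable_fun setT G ->
  (forall x, 0 <= G x) -> {ae mu, forall x, f x <= G x} ->
  \int[mu]_x f x <= \int[mu]_x G x.
Proof.
move=> mG G0 fG; rewrite integralE.
apply: (@le_trans _ _ (\int[mu]_x f^\+ x)).
  by rewrite geeDl // oppe_le0 integral_ge0.
rewrite ge0_integralTE //; apply: ge_ereal_sup => _ [h hf <-].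
rewrite -integralT_nnsfun; apply: ae_ge0_le_integral => //.
- by move=> x _; rewrite lee_fin.
- exact/measurable_EFinP.
move: fG; apply: filterS => x fG _; apply: (le_trans (hf x)).
by rewrite funeposE ge_max fG G0.
Qed.

Lemma measurable_limn_einf (f : (T -> \bar R)^nat) :
  (forall n, measurable_fun setT (f n)) ->
  measurable_fun setT (fun x => limn_einf (f ^~ x)).
Proof.
move=> mf; have -> : (fun x => limn_einf (f ^~ x)) =
    (fun x => - limn_esup (fun n => - f n x)).
  by apply/funext => x; have := limn_esupN (f ^~ x); rewrite /comp => ->;
    rewrite oppeK.
apply: measurableT_comp => //; apply: (measurable_fun_limn_esup (f := fun n x
  => - f n x)).
by move=> n; exact: measurableT_comp.
Qed.

Lemma limn_einf_le (u : (\bar R)^nat) b : (forall n, u n <= b) -> limn_einf u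
  <= b.
Proof.
move=> ub; rewrite limn_einf_lim; apply: lime_le; first exact: is_cvg_einfs.
by apply: nearW => n; apply: (le_trans _ (ub n)); apply: ereal_inf_lbound;
  exists n => /=.
Qed.

End integral_bounds.

(** In the step from m to m+1 the left side gains (p + m + 1)^2 and the right
    side (p + 2m + 1) (p + 2m + 2). *)
Lemma leq_sqr_fact p m : ((p + m)`! ^ 2 <= p`! * (p + m.*2)`!)%N.
Proof.
elim: m => [|m IH]; first by rewrite double0 addn0 expnS expn1.
rewrite doubleS !addnS !factS expnMn.
apply: (@leq_trans ((p + m).+1 ^ 2 * (p`! * (p + m.*2)`!))).
  by rewrite leq_mul2l IH orbT.
rewrite mulnCA leq_mul2l; apply/orP; right; rewrite mulnA leq_mul2r;
  apply/orP; right.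
rewrite expnS expn1 -addnn addnA leq_mul // !ltnS ?leq_addr //.
by rewrite (leq_trans _ (leqnSn _)) // leq_addr.
Qed.

Lemma leq_sqr_fact_sum p q k : (p + q = 2 * k)%N -> (k`! ^ 2 <= p`! * q`!)%N.
Proof.
wlog pk : p q / (p <= k)%N => [hwlog|] e.
  have [pk|kp] := leqP p k; first exact: hwlog.
  by rewrite mulnC; apply: hwlog; lia.
have -> : q = (p + (k - p).*2)%N by rewrite -addnn; lia.
have {1}-> : k = (p + (k - p))%N by rewrite subnKC.
exact: leq_sqr_fact.
Qed.

Section signature_second_moment.
Context {disp : measure_display} {Omega : measurableType disp} {R : realType}.
Variables (P : probability Omega R) (H : R) (d : nat) (B : 'I_d -> R -> {RV P
  >-> R}).
Hypotheses (hB : fractional_brownian_motion H B) (hH : 2^-1 < H < 1).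
Variables (s t : R) (i0 : 'I_d).
Hypotheses (s0 : 0 <= s) (st : s <= t).

Local Notation path w := (fun i u => B i u w).

(** A Hoelder exponent between 1/2 and H makes the Young integrals converge. *)
Lemma ae_cvg_grid_signature : {ae P, forall w, forall I : seq 'I_d,
  grid_signature (path w) I s t N N.+1 @[N --> \oo] --> signature (path w) I s
    t}.
Proof.
have /andP[h1 h2] := hH.
pose gamma := (H + 2^-1) / 2.
have g1 : 2^-1 < gamma by rewrite /gamma; lra.
have g2 : gamma <= 1 by rewrite /gamma; lra.
have gH : 0 < gamma < H by rewrite /gamma; apply/andP; split; lra.
have : {ae P, forall w, forall i, locally_hoelder gamma (fun u => B i u w)}.
  by apply: filter_forall => i; exact: fbm_hoelder hB i _ gH.
apply: filterS => w hw I; apply: (cvg_grid_signature st g1 g2) => i.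
have [C hC] := hw i t (le_trans s0 st).
exists `|C| => // u v su uv vt.
apply: (le_trans (hC v u _ _)).
- by rewrite vt (le_trans s0) // (le_trans su).
- by rewrite (le_trans s0 su) (le_trans uv).
by rewrite ger0_norm ?subr_ge0 // ler_wpM2r ?powR_ge0 // ler_norm.
Qed.

(** A measurable version of the square of the signature. *)
Definition signature_sqr I w : \bar R :=
  limn_einf (fun N => (grid_signature (path w) I s t N N.+1 ^+ 2)%:E).

Lemma signature_sqr_ae : {ae P, forall w, forall I : seq 'I_d,
  signature_sqr I w = (signature (path w) I s t ^+ 2)%:E}.
Proof.
apply: filterS ae_cvg_grid_signature => w hw I.
have [] // := @cvg_limn_einf_sup _ (fun N => (grid_signature (path w) I s t N
  N.+1 ^+ 2)%:E)
  (signature (path w) I s t ^+ 2)%:E _.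
apply: cvg_EFin; first by near=> N.
have -> : fine \o (fun N => (grid_signature (path w) I s t N N.+1 ^+ 2)%:E) =
  (fun N => grid_signature (path w) I s t N N.+1 * grid_signature (path w) I s
    t N N.+1).
  by apply/funext => N /=; rewrite expr2.
by rewrite expr2; apply: cvgM; exact: hw.
Unshelve. all: end_near. Qed.

Let hgrid I N l : has_moments P (fun w => grid_signature (path w) I s t N l).
Proof.
rewrite /grid_signature; elim/last_ind: I l => [|I i IH] l;
  first exact: has_moments_cst.
under eq_fun do rewrite discrete_signature_rcons.
have g0 j : 0 <= grid s t N j by rewrite addr_ge0 // mulr_ge0 // divr_ge0 //
  subr_ge0.
apply: has_moments_sum => j; apply: has_momentsM => //.
exact: (fbm_incr_has_moments hB).
Qed.

Lemma measurable_signature_sqr I : measurable_fun setT (signature_sqr I).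
Proof.
apply: measurable_limn_einf => N; apply/measurable_EFinP.
exact: (has_momentsX 2 (hgrid I N N.+1)).1.
Qed.

Lemma signature_sqr_ge0 I w : (0 <= signature_sqr I w)%E.
Proof.
rewrite /signature_sqr limn_einf_lim; apply: lime_ge; first exact: is_cvg_einfs.
apply: nearW => n; apply: le_ereal_inf_tmp => _ [m /= _ <-].
by rewrite lee_fin sqr_ge0.
Qed.

Lemma integral_signature_sqr_le I : (\int[P]_w signature_sqr I w <=
  ((4 * (t - s) `^ (2 * H)) ^+ size I / (size I)`!%:R)%:E)%E.
Proof.
have /andP[h1 h2] := hH.
apply: le_trans.
  apply: (fatou P measurableT
    (f := fun N w => (grid_signature (path w) I s t N N.+1 ^+ 2)%:E)).
    move=> N; apply/measurable_EFinP; exact: (has_momentsX 2 (hgrid I N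
      N.+1)).1.
  by move=> N w _; rewrite lee_fin sqr_ge0.
apply: limn_einf_le => N.
have := mean_discrete_signature_sqr hB h1 N i0 s0 st I.
rewrite -lee_fin /mean /Rintegral fineK //.
exact: integrable_fin_num (has_moments_integrable (has_momentsX 2 (hgrid I N
  N.+1))).
Qed.

End signature_second_moment.

Theorem theorem3p1 (R : realType) (disp : measure_display)
    (Omega : measurableType disp) (P : probability Omega R)
    (d : nat) (hd : (1 <= d)%N) (H : R) (hH : 2^-1 < H < 1)
    (B : 'I_d -> R -> {RV P >-> R}) (hB : fractional_brownian_motion H B)
    (T : R) (hT : 0 < T) (k p q : nat) (hk : (1 <= k)%N)
    (hpq : (p + q = 2 * k)%N) (I : p.-tuple 'I_d) (J : q.-tuple 'I_d)
    (s t : R) (hs : 0 <= s) (hst : s < t) (ht : t <= T) :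
  ('E_P[fun w => (signature (fun i u => B i u w) I s t *
                  signature (fun i u => B i u w) J s t)%R]
   <= (2 ^+ (2 * k) / k`!%:R * (t - s) `^ (2 * k%:R * H))%:E)%E.
Proof.
pose i0 : 'I_d := Ordinal hd.
pose a : R := 4 * (t - s) `^ (2 * H).
have a0 : 0 < a by rewrite mulr_gt0 // powR_gt0 // subr_gt0.
pose A n : R := a ^+ n / n`!%:R.
have f0 n : 0 < n`!%:R :> R by rewrite ltr0n fact_gt0.
have A0 n : 0 < A n by rewrite divr_gt0 // exprn_gt0.
have -> : 2 ^+ (2 * k) / k`!%:R * (t - s) `^ (2 * k%:R * H) = A k.
  have -> : 2 * k%:R * H = 2 * H * k%:R by ring.
  rewrite powRrM powR_mulrn ?powR_ge0 // /A /a exprMn exprM.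
  by rewrite mulrAC; congr (_ ^+ _ * _ / _); rewrite expr2; ring.
have AA : A p * A q <= A k ^+ 2.
  rewrite /A mulf_div -exprD hpq expr_div_n -exprM mulnC.
  rewrite ler_pM2l ?exprn_gt0 // lef_pV2 ?posrE ?mulr_gt0 ?exprn_gt0 //.
  by rewrite -natrM -natrX ler_nat leq_sqr_fact_sum.
(* With this weight the first of the two terms is exactly A k / 2. *)
pose lam := A k / A p.
have lam0 : 0 < lam by rewrite divr_gt0.
pose c1 := lam / 2; pose c2 := lam^-1 / 2.
have c10 : 0 <= c1 by rewrite divr_ge0 // ltW.
have c20 : 0 <= c2 by rewrite divr_ge0 // invr_ge0 ltW.
pose S2 := signature_sqr B s t.
pose G w := (c1%:E * S2 I w + c2%:E * S2 J w)%E.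
have mS K : measurable_fun setT (S2 K) by exact: (measurable_signature_sqr hB
  hs (ltW hst)).
have S0 K w : (0 <= S2 K w)%E by exact: signature_sqr_ge0.
rewrite unlock; apply: (@le_trans _ _ (\int[P]_w G w)%E).
  apply: integral_le_ae_dominated.
  - by apply: emeasurable_funD; exact: measurable_funeM.
  - by move=> w; rewrite adde_ge0 // mule_ge0 // lee_fin.
  have := signature_sqr_ae hB hH hs (ltW hst).
  apply: filterS => w hw; rewrite /G /S2 !hw -!EFinM -EFinD lee_fin.
  move: (signature _ I s t) (signature _ J s t) => y z.
  rewrite -subr_ge0.
  have -> : c1 * y ^+ 2 + c2 * z ^+ 2 - y * z = (lam * y - z) ^+ 2 / (2 * lam).
    by rewrite /c1 /c2; field; rewrite gt_eqF.
  by rewrite divr_ge0 ?sqr_ge0 // mulr_ge0 // ltW.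
rewrite ge0_integralD //; last 4 first.
- by move=> w _; rewrite mule_ge0 // lee_fin.
- exact: measurable_funeM.
- by move=> w _; rewrite mule_ge0 // lee_fin.
- exact: measurable_funeM.
rewrite !ge0_integralZl ?lee_fin //.
have bound K : (\int[P]_w S2 K w <= (A (size K))%:E)%E.
  exact: (integral_signature_sqr_le hB hH i0 hs (ltW hst)).
apply: (@le_trans _ _ (c1%:E * (A p)%:E + c2%:E * (A q)%:E)%E).
  by apply: leeD; rewrite lee_wpmul2l ?lee_fin //;
    [have := bound I | have := bound J]; rewrite size_tuple.
rewrite -!EFinM -EFinD lee_fin /c1 /c2 /lam.
have -> : A k / A p / 2 * A p = A k / 2 by field; rewrite gt_eqF.
have -> : (A k / A p)^-1 / 2 * A q = (A p * A q) / (A k * 2).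
  by field; rewrite !gt_eqF.
have : A p * A q / (A k * 2) <= A k / 2.
  rewrite ler_pdivrMr; last by rewrite mulr_gt0.
  by have -> : A k / 2 * (A k * 2) = A k ^+ 2 by field.
by lra.
Qed.
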